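(* Let $b\ge2$ be an integer and let $w$ be a non-empty word over the alphabet of digits $\{0,1,\dots,b-1\}$, with first digit $w_1$. Consider the series $$\sum_{j=1}^\infty \mathfrak L_j(b,w)\,\lambda_j(w)^{-1}\,\mathfrak R_j(b,w)$$ obtained by formally putting $k=0$ in the series $\sum_{j\ge1}\mathfrak L_j(b,w)\lambda_j(w)^{k-1}\mathfrak R_j(b,w)$. Then: \begin{itemize} \item if $w$ is unbordered and $w_1\neq0$, the series is divergent; \item if $w$ is unbordered and $w_1=0$, the series is absolutely convergent and its sum is $I(b,w,0)$; \item if $w$ is bordered and $v$ is its longest border, the series is absolutely convergent and its sum is $I(b,w,0)-I(b,v,0)$. \end{itemize}
   Context: Words and occurrences. Words are finite sequences (possibly empty) of digits in $\Sigma_b=\{0,\dots,b-1\}$; leading zeros are allowed. For a word $g$, $|g|$ is its length, $g_1$ its first digit, $n(g)$ the non-negative integer it represents in base $b$ (most significant digit on the left, $n(\text{empty})=0$), $x(g)=n(g)/b^{|g|}\in[0,1)$, and $\phi_g(t)=x(g)+b^{-|g|}t$. $k_w(g)$ is the number of (possibly overlapping) occurrences of $w$ as a contiguous block in $g$. A border of $w$ is a non-empty word, distinct from $w$, which is both a prefix and a suffix of $w$. $w$ is bordered if it has a border, and unbordered otherwise (words of length $1$ are unbordered). For a non-empty word $u$, $I(b,u,k)$ is the sum of $1/n$ over all positive integers $n$ whose base-$b$ representation (without leading zeros) contains exactly $k$ (possibly overlapping) occurrences of $u$. Languages attached to $w$: $\mathcal L$ is the set of words containing exactly one occurrence of $w$,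 which is terminal (a suffix of the word); $\mathcal R$ is the set of words $g$ (including the empty word) with $k_w(wg)=1$; $\mathcal G$ is the set of words $g$ such that $wg$ contains exactly two occurrences of $w$, the second one being terminal. For $j\ge1$, $\lambda_j(w)=\sum_{g\in\mathcal G}b^{-j|g|}>0$; one has $\lambda_1(w)=1$. $\nu_j$ is the unique Borel probability measure on $[0,1]$ with $\sum_{g\in\mathcal G}b^{-j|g|}(\phi_g)_*\nu_j=\lambda_j(w)\nu_j$ (so $\nu_1$ is Lebesgue measure). For $m\ge0$, $B_m$ is the unique monic polynomial of degree $m$ with $\mathsf K_wB_m=\lambda_{m+1}(w)B_m$, where $(\mathsf K_wf)(x)=\sum_{g\in\mathcal G}b^{-|g|}f(\phi_g(x))$. Let $\eta_0=\sum_{g\in\mathcal R}b^{-|g|}\delta_{x(g)}$, a finite measure on $[0,1)$, and $$f_{\mathcal L}(z)=\sum_{g\in\mathcal L,\ g_1>0}\frac1{n(g)+z}.$$ The modal coefficients are, for $j\ge1$, $$\mathfrak L_j(b,w)=\frac1{(j-1)!}\int_0^1 f_{\mathcal L}^{(j-1)}(t)\,d\nu_j(t),\qquad \mathfrak R_j(b,w)=\int_{[0,1)}B_{j-1}(x)\,d\eta_0(x).$$ *)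

(* Defs.v *)
From HB Require Import structures.
From mathcomp Require Import all_boot all_order all_algebra.
From mathcomp Require Import all_classical all_reals all_analysis.
Import Order.TTheory GRing.Theory Num.Theory.
Import numFieldNormedType.Exports.

Set Implicit Arguments.
Unset Strict Implicit.
Unset Printing Implicit Defensive.

Local Open Scope classical_set_scope.
Local Open Scope ring_scope.

(* Words are read with the most significant digit first. *)

Notation word b := (seq 'I_b).

(* The default 0 is only reached by the empty word. *)
Definition first_digit (b : nat) (g : word b) : nat :=
  head 0%N (map (@nat_of_ord b) g).

Definition nval (b : nat) (g : word b) : nat :=
  foldl (fun a (d : 'I_b) => (b * a + d)%N) 0%N g.

Definition occ (b : nat) (u g : word b) : nat :=
  count (fun i => prefix u (drop i g)) (iota 0 (size g).+1).

Definition border (b : nat) (v w : word b) : Prop :=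
  [/\ v <> [::], v <> w, prefix v w & suffix v w].

Definition bordered (b : nat) (w : word b) : Prop := exists v, border v w.

Definition longest_border (b : nat) (v w : word b) : Prop :=
  border v w /\ forall u, border u w -> (size u <= size v)%N.

Definition langL (b : nat) (w : word b) : set (word b) :=
  [set g | occ w g = 1%N /\ suffix w g].

Definition langR (b : nat) (w : word b) : set (word b) :=
  [set g | occ w (w ++ g) = 1%N].

Definition langG (b : nat) (w : word b) : set (word b) :=
  [set g | occ w (w ++ g) = 2%N /\ suffix w (w ++ g)].

(* Unordered sum of a family of real numbers of arbitrary sign; it is only
   meaningful for absolutely summable families. *)
Definition sum_over (R : realType) (T : choiceType) (A : set T) (f : T -> R)
    : R :=
  fine (\esum_(g in A) (Num.max (f g) 0)%:E)
  - fine (\esum_(g in A) (Num.max (- f g) 0)%:E).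

(* Sum of 1/n over the integers n > 0 whose base-b representation, i.e. the
   word g of value n with non-zero first digit, has k occurrences of u. *)
Definition Iharm (R : realType) (b : nat) (u : word b) (k : nat) : \bar R :=
  \esum_(n in [set n : nat | (0 < n)%N /\ exists g : word b,
      [/\ nval g = n, (0 < first_digit g)%N & occ u g = k]])
    (n%:R^-1)%:E.

Definition xval (R : realType) (b : nat) (g : word b) : R :=
  (nval g)%:R / b%:R ^+ size g.

Definition phi (R : realType) (b : nat) (g : word b) (t : R) : R :=
  xval R g + b%:R ^- size g * t.

Definition lambda (R : realType) (b : nat) (w : word b) (j : nat) : R :=
  fine (\esum_(g in langG w) (b%:R ^- (j * size g) : R)%:E).

(* A Borel probability on [0, 1] is encoded as a Borel probability on R giving
   mass 1 to [0, 1]. *)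
Definition stationary (R : realType) (b : nat) (w : word b) (j : nat)
    (nu : probability (measurableTypeR R) R) : Prop :=
  nu `[0%R, 1%R]%classic = 1%E /\
  forall A : set (measurableTypeR R), measurable A ->
    (\esum_(g in langG w)
        (b%:R ^- (j * size g))%:E * pushforward nu (@phi R b g) A
     = (lambda R w j)%:E * nu A)%E.

Definition Kop (R : realType) (b : nat) (w : word b) (f : R -> R) (x : R) : R :=
  sum_over (langG w) (fun g => b%:R ^- size g * f (phi g x)).

Definition modal_poly (R : realType) (b : nat) (w : word b) (m : nat)
    (p : {poly R}) : Prop :=
  [/\ p \is monic, size p = m.+1 &
      forall x : R, Kop w (horner p) x = lambda R w m.+1 * p.[x]].

Definition eta0 (R : realType) (b : nat) (w : word b)
    (A : set (measurableTypeR R)) : \bar R :=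
  (\esum_(g in langR w) (b%:R ^- size g)%:E * \d_(xval R g) A)%E.

Lemma esum_exchange (R : realType) (T1 T2 : choiceType) (I : set T1)
    (J : set T2) (a : T1 -> T2 -> \bar R) :
  (forall i j, 0 <= a i j)%E ->
  \esum_(i in I) \esum_(j in J) a i j = \esum_(j in J) \esum_(i in I) a i j.
Proof.
move=> a0; rewrite !esum_esum//.
rewrite (reindex_esum (J `*`` fun=> I) (I `*`` fun=> J)
  (fun k => (k.2, k.1)))//; split.
- by move=> [j i] [].
- by move=> [j i] [j' i'] _ _ [-> ->].
- by move=> [i j] [Ii Jj]; exists (j, i).
Qed.

Lemma eta0_term_ge0 (R : realType) (b : nat) (g : word b)
    (A : set (measurableTypeR R)) :
  (0 <= (b%:R ^- size g : R)%:E * \d_(xval R g) A)%E.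
Proof. by apply: mule_ge0 => //; rewrite lee_fin invr_ge0 exprn_ge0. Qed.

Lemma eta0_set0 (R : realType) (b : nat) (w : word b) :
  eta0 w set0 = 0 :> \bar R.
Proof. by apply: esum1 => g _; rewrite measure0 mule0. Qed.

Lemma eta0_ge0 (R : realType) (b : nat) (w : word b)
    (A : set (measurableTypeR R)) : (0 <= eta0 w A)%E.
Proof. by apply: esum_ge0 => g _; exact: eta0_term_ge0. Qed.

Lemma eta0_sigma_additive (R : realType) (b : nat) (w : word b) :
  semi_sigma_additive (@eta0 R b w).
Proof.
move=> F mF tF mUF.
have -> : eta0 w (\bigcup_n F n) = (\sum_(0 <= i <oo) eta0 w (F i))%E.
  rewrite nneseries_esumT; last by move=> n; exact: eta0_ge0.
  rewrite /eta0 esum_exchange; last by move=> *; exact: eta0_term_ge0.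
  apply: eq_esum => g _.
  rewrite measure_semi_bigcup// -nneseries_esumT; last first.
    by move=> n; exact: eta0_term_ge0.
  by rewrite nneseriesZl.
by apply: is_cvg_ereal_nneg_natsum => n _; exact: eta0_ge0.
Qed.

HB.instance Definition _ (R : realType) (b : nat) (w : word b) :=
  isMeasure.Build _ _ _ (@eta0 R b w) (eta0_set0 R w) (@eta0_ge0 R b w)
    (@eta0_sigma_additive R b w).

(* The terms are positive and smooth for z > -1, so the two-sided derivatives in
   modalL agree with the derivatives on [0, 1], endpoints included. *)
Definition fL (R : realType) (b : nat) (w : word b) (z : R) : R :=
  sum_over [set g | langL w g /\ (0 < first_digit g)%N]
    (fun g => ((nval g)%:R + z)^-1).

Definition modalL (R : realType) (b : nat) (w : word b)
    (nu : nat -> probability (measurableTypeR R) R) (j : nat) : R :=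
  (j.-1)`!%:R^-1 * \int[nu j]_(t in `[0%R, 1%R]) (derive1n j.-1 (@fL R b w) t).

Definition modalR (R : realType) (b : nat) (w : word b)
    (B : nat -> {poly R}) (j : nat) : R :=
  \int[eta0 w]_(x in `[0%R, 1%R[) (B j.-1).[x].

(* Main.v *)
(* Let [v] be the longest border of [w], or the empty word, and let [w = v c].
   The words of [G] all end in [c], the shortest of them, so that [G] is governed
   by the fixed point [q] of [phi c].  The functionals [p |-> \int p^(i)/i! dnu_(i+1)]
   are dual to the modal polynomials [B i], because [d^i/dx^i] turns the eigenvalue
   equation of [B m] into the stationarity of [nu_(i+1)] with a different eigenvalue
   unless [i = m].  Expanding [(x - q)^m] in the [B i] and summing the moments of
   the [nu_(i+1)] around [q] over all [i] at once gives [|B m (x)| <= C r^m] for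
   [|x - q| <= r] as soon as [r > 1 + b^-|c|].  Hence the modal expansion
     1/(s + z) = \sum_i (-1)^i (\int (s + t)^-(i+1) dnu_(i+1)) B i (z)
   converges geometrically when [|z - q| <= r < s + q], and it may be summed over
   a family of poles [s].

   If [w] is bordered, words of [L(w)] are uniquely [a g] with [a] in [L(v)] and
   [g] in [G], so stationarity absorbs [lambda_(i+1)^-1] and replaces the poles by
   the values of [L(v)]; summing over [z = x(h)], [h] in [R], gives the sum of
   [1/n(a h)], that is, of [1/n] over the words that avoid [w] and contain [v].
   If [w] is unbordered, [R w = G], so the right coefficient is
   [b^|w| lambda_(i+1) B i (- n(w))]; for [w_1 = 0] all the poles lie far enough
   for the expansion at [z = - n(w)], whereas for [w_1 <> 0] the pole [s = n(w)]
   gives [s + q = |z - q|] and the terms stay away from 0. *)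

Require Import Defs.
From mathcomp Require Import all_boot all_order all_algebra.
From mathcomp Require Import all_classical all_reals all_analysis.
From mathcomp Require Import measurable_realfun ring lra zify.
Import Order.TTheory GRing.Theory Num.Theory.
Import numFieldNormedType.Exports.
Set Implicit Arguments.
Unset Strict Implicit.
Unset Printing Implicit Defensive.
Local Open Scope classical_set_scope.
Local Open Scope ring_scope.


(** * Unordered sums of real families *)

(** The weight b^-(j|g|) favours the shortest word [c] more and more as j grows, so nu_j
    concentrates at q; this is why every expansion is centred there. What is needed of this
    concentration is a single estimate, on the coefficients of (x - q)^m along the modes below m,
    weighted by r^i: their sum is at most a constant times rate(r)^m, with rate(r) < r. The estimate
    serves three times: through a convergent product it bounds B m from above, as a bound on each
    discarded term it makes the pole expansion geometric, and as a small perturbation it bounds the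
    terms from below in the divergent case.

    Infinite double series in modes and powers are never rearranged. The first J modes reproduce
    every polynomial of degree less than J exactly, so the error after J modes is a tail of the
    expansion of 1/(s + z) in powers of z - q. Its rate is uniform in z and its constant is
    proportional to 1/(s + q), and this is what allows summation over the poles and over R. *)

Section RealSums.
Variables (R : realType) (T : choiceType).
Implicit Types (A : set T) (f g : T -> R).

Definition absum A f : Prop := (\esum_(i in A) `|f i|%:E < +oo)%E.

Lemma absum_fin A f : absum A f -> \esum_(i in A) `|f i|%:E \is a fin_num.
Proof.
by move=> fA; rewrite ge0_fin_numE//; apply: esum_ge0 => i _; rewrite lee_fin.
Qed.

Lemma absum_le A f g : (forall i, A i -> `|f i| <= g i) -> absum A g ->
  absum A f.
Proof.
move=> fg; apply: le_lt_trans; apply: le_esum => i Ai; rewrite lee_fin.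
by apply: le_trans (fg _ Ai) _; exact: ler_norm.
Qed.

Lemma absum_ge0 A f : (forall i, A i -> 0 <= f i) ->
  (\esum_(i in A) (f i)%:E < +oo)%E -> absum A f.
Proof.
move=> f0; rewrite /absum; congr (_ < _)%E; apply: eq_esum => i Ai.
by rewrite ger0_norm// f0.
Qed.

Lemma absumD A f g : absum A f -> absum A g -> absum A (fun i => f i + g i).
Proof.
move=> fA gA; rewrite /absum.
apply: (@le_lt_trans _ _ (\esum_(i in A) (`|f i|%:E + `|g i|%:E))%E).
  by apply: le_esum => i Ai; rewrite -EFinD lee_fin ler_normD.
by rewrite esumD ?lte_add_pinfty// => i _; rewrite lee_fin.
Qed.

(** Only the inequality from left to right is proved on finite subsums; applied to [c^-1] and to the
    scaled family, it gives the converse. *)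
Lemma esumZl A (c : R) (a : T -> \bar R) : 0 <= c ->
  (forall i, A i -> (0 <= a i)%E) ->
  (\esum_(i in A) (c%:E * a i) = c%:E * \esum_(i in A) a i)%E.
Proof.
move=> c0 a0; have c0e : (0 <= c%:E)%E by rewrite lee_fin.
have [->|cN0] := eqVneq c 0.
  by rewrite mul0e esum1// => i _; rewrite mul0e.
have le0 (k : R) (u : T -> \bar R) : 0 <= k -> (forall i, A i -> (0 <= u i)%E) ->
    (\esum_(i in A) (k%:E * u i) <= k%:E * \esum_(i in A) u i)%E.
  move=> k0 u0; apply: ge_ereal_sup => _ [X [fX XA]] <-.
  rewrite fsbig_finite//= big_seq_cond -ge0_sume_distrr; last first.
    by move=> i /andP[+ _]; rewrite in_fset_set// inE => /XA/u0.
  rewrite -big_seq_cond lee_wpmul2l// -fsbig_finite//; apply: esum_ge.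
  by exists X.
apply/eqP; rewrite eq_le le0//=.
have := le0 c^-1 (fun i => c%:E * a i)%E.
rewrite invr_ge0 => /(_ c0 (fun i Ai => mule_ge0 c0e (a0 i Ai))).
under eq_esum do rewrite muleA -EFinM mulVf// mul1e.
move=> /(lee_wpmul2l c0e); rewrite muleA -EFinM divff// mul1e; exact.
Qed.

Lemma absumZ A (c : R) f : absum A f -> absum A (fun i => c * f i).
Proof.
move=> fA; rewrite /absum; under eq_esum do rewrite normrM EFinM.
by rewrite esumZl// lte_mul_pinfty// lee_fin.
Qed.

Lemma absumB A f g : absum A f -> absum A g -> absum A (fun i => f i - g i).
Proof.
move=> fA gA; under eq_fun do rewrite -mulN1r.
by apply: absumD => //; exact: absumZ.
Qed.

Lemma absum_sum A (I : Type) (r : seq I) (F : I -> T -> R) :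
  (forall k, absum A (F k)) -> absum A (fun i => \sum_(k <- r) F k i).
Proof.
move=> FA; elim: r => [|k r IH].
  under eq_fun do rewrite big_nil.
  by rewrite /absum esum1 => [//|i _]; rewrite normr0.
by under eq_fun do rewrite big_cons; exact: absumD.
Qed.

Lemma sum_over_ge0E A f : (forall i, A i -> 0 <= f i) ->
  sum_over A f = fine (\esum_(i in A) (f i)%:E).
Proof.
move=> f0; rewrite /sum_over [X in _ - fine X]esum1 ?subr0 => [|i Ai].
  by congr fine; apply: eq_esum => i Ai; rewrite max_l ?f0.
by rewrite max_r// oppr_le0 f0.
Qed.

Lemma sum_overE A f : (forall i, A i -> 0 <= f i) -> absum A f ->
  (sum_over A f)%:E = \esum_(i in A) (f i)%:E.
Proof.
move=> f0 fA; rewrite sum_over_ge0E// fineK//.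
have -> : \esum_(i in A) (f i)%:E = \esum_(i in A) `|f i|%:E.
  by apply: eq_esum => i Ai; rewrite ger0_norm// f0.
exact: absum_fin.
Qed.

Lemma eq_sum_over A f g : (forall i, A i -> f i = g i) ->
  sum_over A f = sum_over A g.
Proof.
by move=> fg; rewrite /sum_over; congr (fine _ - fine _);
  apply: eq_esum => i Ai; rewrite fg.
Qed.

(** Linearity of [sum_over] rests on this case, since an absolutely summable family is the
    difference of its positive and negative parts. *)
Lemma sum_over_diff A f g : (forall i, A i -> 0 <= f i) ->
  (forall i, A i -> 0 <= g i) -> absum A f -> absum A g ->
  sum_over A (fun i => f i - g i) = sum_over A f - sum_over A g.
Proof.
move=> f0 g0 fA gA.
have := @esumB R T A (EFin \o f) (EFin \o g) fA gA.
rewrite -[X in _ = X](_ : ((sum_over A f)%:E - (sum_over A g)%:E)%E = _);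
  last by rewrite !sum_overE.
have pE : (\esum_(i in A) ((EFin \o f) \- (EFin \o g))^\+ i =
    \esum_(i in A) (Num.max (f i - g i)%R 0%R)%:E)%E.
  by apply: eq_esum => i Ai; rewrite funeposE EFin_max.
have nE : (\esum_(i in A) ((EFin \o f) \- (EFin \o g))^\- i =
    \esum_(i in A) (Num.max (- (f i - g i))%R 0%R)%:E)%E.
  by apply: eq_esum => i Ai; rewrite funenegE EFin_max.
rewrite pE nE => /(_ f0 g0) h.
have dA : absum A (fun i => f i - g i) by exact: absumB.
have fin h' : (forall i, A i -> 0 <= h' i <= `|f i - g i|) ->
    \esum_(i in A) (h' i)%:E \is a fin_num.
  move=> hh; rewrite ge0_fin_numE; last first.
    by apply: esum_ge0 => i /hh/andP[]; rewrite lee_fin.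
  by apply: le_lt_trans dA; apply: le_esum => i /hh/andP[]; rewrite lee_fin.
have e1 : \esum_(i in A) (Num.max (f i - g i) 0)%:E \is a fin_num.
  by apply: fin => i _; rewrite le_max lexx orbT ge_max ler_norm normr_ge0.
have e2 : \esum_(i in A) (Num.max (- (f i - g i)) 0)%:E \is a fin_num.
  apply: fin => i _; rewrite le_max lexx orbT ge_max -normrN ler_norm.
  exact: normr_ge0.
by rewrite /sum_over; apply: EFin_inj; rewrite [RHS]EFinB -h EFinB !fineK.
Qed.

Let pos f i := Num.max (f i) 0.
Let neg f i := Num.max (- f i) 0.

Let posneg f i : f i = pos f i - neg f i.
Proof. by rewrite /pos /neg; case: (leP 0 (f i)) => ?; case: leP; lra. Qed.

Let pos_ge0 f i : 0 <= pos f i. Proof. by rewrite le_max lexx orbT. Qed.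
Let neg_ge0 f i : 0 <= neg f i. Proof. by rewrite le_max lexx orbT. Qed.

Let absum_pos A f : absum A f -> absum A (pos f).
Proof.
move=> fA; apply: absum_le (fun i => `|f i|) _ _ => [i _|].
  by rewrite ger0_norm// ge_max ler_norm normr_ge0.
by move: fA; rewrite /absum; under eq_esum do rewrite -normr_id.
Qed.

Let absum_neg A f : absum A f -> absum A (neg f).
Proof.
move=> fA; apply: absum_le (fun i => `|f i|) _ _ => [i _|].
  by rewrite ger0_norm// ge_max -normrN ler_norm normr_ge0.
by move: fA; rewrite /absum; under eq_esum do rewrite -normr_id.
Qed.

Let sum_over_pn A f : absum A f ->
  sum_over A f = sum_over A (pos f) - sum_over A (neg f).
Proof.
move=> fA; rewrite -sum_over_diff//; [|exact: absum_pos|exact: absum_neg].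
by apply: eq_sum_over => i _; exact: posneg.
Qed.

Let sum_over_ge0D A f g : (forall i, A i -> 0 <= f i) ->
  (forall i, A i -> 0 <= g i) -> absum A f -> absum A g ->
  sum_over A (fun i => f i + g i) = sum_over A f + sum_over A g.
Proof.
move=> f0 g0 fA gA; apply: EFin_inj; rewrite [RHS]EFinD !sum_overE//.
- by rewrite -esumD//.
- by move=> i Ai; rewrite addr_ge0 ?f0 ?g0.
- exact: absumD.
Qed.

Lemma sum_overD A f g : absum A f -> absum A g ->
  sum_over A (fun i => f i + g i) = sum_over A f + sum_over A g.
Proof.
move=> fA gA.
have pf := absum_pos fA; have nf := absum_neg fA.
have pg := absum_pos gA; have ng := absum_neg gA.
rewrite (_ : sum_over A _ = sum_over A
    (fun i => (pos f i + pos g i) - (neg f i + neg g i))); last first.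
  by apply: eq_sum_over => i _; rewrite (posneg f) (posneg g); ring.
rewrite sum_over_diff; first last.
- exact: absumD.
- exact: absumD.
- by move=> *; rewrite addr_ge0.
- by move=> *; rewrite addr_ge0.
by rewrite !sum_over_ge0D// (sum_over_pn fA) (sum_over_pn gA); ring.
Qed.

Lemma sum_overN A f : sum_over A (fun i => - f i) = - sum_over A f.
Proof.
rewrite /sum_over opprB; congr (_ - fine _).
by apply: eq_esum => i _; rewrite opprK.
Qed.

Lemma sum_overB A f g : absum A f -> absum A g ->
  sum_over A (fun i => f i - g i) = sum_over A f - sum_over A g.
Proof.
move=> fA gA; rewrite -sum_overN -sum_overD//.
by move: gA; rewrite /absum; under eq_esum do rewrite -normrN.
Qed.

Lemma sum_overZ A c f : absum A f ->
  sum_over A (fun i => c * f i) = c * sum_over A f.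
Proof.
move=> fA; wlog c0 : c / 0 <= c => [h|].
  have [/h//|/ltW c0] := leP 0 c.
  rewrite -[c]opprK mulNr -h ?oppr_ge0// -sum_overN.
  by apply: eq_sum_over => i _; rewrite mulNr.
have Zge0 (h : T -> R) : (forall i, 0 <= h i) -> absum A h ->
    sum_over A (fun i => c * h i) = c * sum_over A h.
  move=> h0 hA; apply: EFin_inj; rewrite [RHS]EFinM !sum_overE//.
  - by under eq_esum do rewrite EFinM; rewrite esumZl// => i _; rewrite lee_fin.
  - by move=> i _; exact: mulr_ge0.
  - exact: absumZ.
rewrite (sum_over_pn fA) mulrBr -!Zge0//; [|exact: absum_neg|exact: absum_pos].
rewrite -sum_overB; [|exact/absumZ/absum_pos|exact/absumZ/absum_neg].
by apply: eq_sum_over => i _; rewrite {1}posneg mulrBr.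
Qed.

Lemma sum_over_sum A (I : Type) (r : seq I) (F : I -> T -> R) :
  (forall k, absum A (F k)) ->
  sum_over A (fun i => \sum_(k <- r) F k i) = \sum_(k <- r) sum_over A (F k).
Proof.
move=> FA; elim: r => [|k r IH].
  rewrite big_nil; under eq_sum_over do rewrite big_nil.
  by rewrite sum_over_ge0E// esum1.
rewrite big_cons -IH -sum_overD//; last exact: absum_sum.
by apply: eq_sum_over => i _; rewrite big_cons.
Qed.

Lemma le_sum_over A f g : (forall i, A i -> f i <= g i) ->
  absum A f -> absum A g -> sum_over A f <= sum_over A g.
Proof.
move=> fg fA gA; rewrite -subr_ge0 -sum_overB// sum_over_ge0E.
  by apply/fine_ge0/esum_ge0 => i Ai; rewrite lee_fin subr_ge0 fg.
by move=> i Ai; rewrite subr_ge0 fg.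
Qed.

Lemma sum_over_ge0 A f : (forall i, A i -> 0 <= f i) -> 0 <= sum_over A f.
Proof.
move=> f0; rewrite sum_over_ge0E//; apply/fine_ge0/esum_ge0 => i Ai.
by rewrite lee_fin f0.
Qed.

Lemma ler_norm_sum_over A f g : (forall i, A i -> `|f i| <= g i) ->
  absum A g -> `|sum_over A f| <= sum_over A g.
Proof.
move=> fg gA; have fA := absum_le fg gA; rewrite ler_norml -sum_overN.
apply/andP; split; apply: le_sum_over => //.
- by move=> i /fg; rewrite ler_norml => /andP[].
- by move: gA; rewrite /absum; under eq_esum do rewrite -normrN.
- by move=> i /fg; rewrite ler_norml => /andP[].
Qed.

Lemma sum_over_ge A f i : A i -> (forall j, A j -> 0 <= f j) -> absum A f ->
  f i <= sum_over A f.
Proof.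
move=> Ai f0 fA; rewrite -lee_fin sum_overE//; apply: esum_ge.
by exists [set i]; rewrite ?fsbig_set1//; split => // _ ->.
Qed.

End RealSums.

Lemma reindex_sum_over (R : realType) (T T' : choiceType) (P : set T)
    (Q : set T') (e : T -> T') (f : T' -> R) :
  set_bij P Q e -> sum_over Q f = sum_over P (f \o e).
Proof.
by move=> eb; rewrite /sum_over !(reindex_esum P Q e).
Qed.

(** * Occurrences, borders and values of words *)

Section Words.
Variable b : nat.
Implicit Types (u v w x y z g h : word b).

Lemma occ_cat u x y : occ u (x ++ y) =
  (count (fun i => prefix u (drop i (x ++ y))) (iota 0 (size x)) + occ u y)%N.
Proof.
rewrite /occ size_cat -addnS iotaD count_cat add0n; congr addn.
rewrite -[in iota _ _](addn0 (size x)) iotaDl count_map; apply: eq_count => i /=.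
by rewrite addnC -drop_drop drop_size_cat.
Qed.

Lemma prefix_catW u x y : (size u <= size x)%N ->
  prefix u (x ++ y) = prefix u x.
Proof.
move=> ux; rewrite !prefixE take_cat; move: ux; rewrite leq_eqVlt => /orP[/eqP->|->//].
by rewrite ltnn subnn take0 cats0 take_size.
Qed.

Lemma occ_gt0 u g i : (i <= size g)%N -> prefix u (drop i g) -> (0 < occ u g)%N.
Proof.
by move=> ig ug; rewrite -has_count; apply/hasP; exists i; rewrite ?mem_iota.
Qed.

Lemma occ_eq0 u g i : occ u g = 0%N -> (i <= size g)%N -> ~~ prefix u (drop i g).
Proof. by move=> u0 ig; apply/negP => /(occ_gt0 ig); rewrite u0. Qed.

Lemma occ_gt0P u g : (0 < occ u g)%N ->
  exists2 i, (i <= size g)%N & prefix u (drop i g).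
Proof.
by rewrite -has_count => /hasP[i]; rewrite mem_iota add0n ltnS; exists i.
Qed.

Lemma occ_size u g : (size g < size u)%N -> occ u g = 0%N.
Proof.
move=> gu; apply/eqP; rewrite eqn0Ngt; apply/negP => /occ_gt0P[i _ /size_prefix].
by rewrite size_drop leqNgt (leq_ltn_trans (leq_subr _ _)).
Qed.

Lemma occ_self u : u <> [::] -> occ u u = 1%N.
Proof.
move=> u0; rewrite /occ -add1n iotaD count_cat.
rewrite (_ : count _ (iota 0 1) = 1%N); last by rewrite /= drop0 prefix_refl.
rewrite (@eq_in_count _ _ pred0) ?count_pred0// => i.
rewrite mem_iota => /andP[i0 _]; apply/negbTE/negP => /size_prefix.
by rewrite size_drop; case: u u0 => //= d u _; lia.
Qed.

Lemma prefix_sub x y z : prefix x z -> prefix y z -> (size x <= size y)%N ->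
  prefix x y.
Proof.
rewrite !prefixE => /eqP xz /eqP yz xy; apply/eqP.
by rewrite -yz take_takel// xz.
Qed.

Lemma suffix_sub x y z : suffix x z -> suffix y z -> (size x <= size y)%N ->
  suffix x y.
Proof.
by rewrite -!prefix_rev => xz yz xy; apply: prefix_sub xz yz _; rewrite !size_rev.
Qed.

(* [v] is the state reached by the Knuth-Morris-Pratt automaton of [w] right
   after an occurrence of [w]: the longest border of [w], or the empty word if
   [w] is unbordered. *)
Definition fallback v w : Prop :=
  [/\ (size v < size w)%N, prefix v w, suffix v w &
      forall u, border u w -> (size u <= size v)%N].

Lemma fallback_longest_border v w : longest_border v w -> fallback v w.
Proof.
move=> [[v0 vw pvw svw] vmax]; split=> //.
rewrite ltn_neqAle (size_prefix pvw) andbT; apply/eqP => e; apply: vw.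
by move: pvw; rewrite prefixE e take_size => /eqP.
Qed.

Lemma fallback_unbordered w : w <> [::] -> ~ bordered w -> fallback [::] w.
Proof.
move=> w0 ub; split; rewrite ?prefix0s ?suffix0s//; first by case: w w0 {ub}.
by move=> u uw; case: ub; exists u.
Qed.

Lemma overlap_border w h i : (0 < i < size w)%N -> prefix w (drop i (w ++ h)) ->
  border (drop i w) w.
Proof.
move=> /andP[i0 iw]; rewrite drop_cat iw => pw.
have sd : (size (drop i w) < size w)%N by rewrite size_drop; lia.
split; rewrite ?suffix_drop//.
- by move=> /(congr1 size)/=; rewrite size_drop; lia.
- by move=> e; rewrite e ltnn in sd.
- by apply: (prefix_sub (prefix_prefix _ h) pw); exact: ltnW.
Qed.

Lemma fallback_cat v w : fallback v w ->
  exists x c, [/\ w = x ++ v, w = v ++ c, x <> [::] & c <> [::]].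
Proof.
move=> [vw /prefixP[c wc] /suffixP[x wx] _]; exists x, c; split=> //.
- by move=> x0; move: vw; rewrite wx x0 ltnn.
- by move=> c0; move: vw; rewrite wc c0 cats0 ltnn.
Qed.

(** Write [w = x ++ v]. An occurrence of [w] in [w ++ h] at a position 0 < i < |w| makes [drop i w]
    a border, hence no longer than [v], so that i >= |x|. Apart from position 0, only the
    occurrences inside [v ++ h] remain. *)
Lemma occ_fallback v w h : fallback v w ->
  occ w (w ++ h) = (occ w (v ++ h)).+1.
Proof.
move=> fvw; have [x [c [wx _ x0 _]]] := fallback_cat fvw.
case: fvw => vw _ _ vmax.
rewrite {2}wx -catA occ_cat catA -wx -add1n; congr addn.
case: x wx x0 => // d x wx _ /=; rewrite drop0 prefix_prefix.
rewrite (@eq_in_count _ _ pred0) ?count_pred0// => i.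
rewrite mem_iota => /andP[i0 ix]; apply/negbTE/negP => /overlap_border.
have iw : (i < size w)%N by rewrite wx size_cat /=; lia.
rewrite i0 iw => /(_ isT)/vmax; rewrite size_drop wx size_cat /=; lia.
Qed.

(** An occurrence of [w] begins with [v], and [v] occurs in [a] only at its end, so no occurrence of
    [w] starts before this final [v]. *)
Lemma occ_first v w a h : fallback v w -> v <> [::] -> langL v a ->
  occ w (a ++ h) = occ w (v ++ h).
Proof.
move=> [vw pvw _ _] v0 [oa /suffixP[y ay]].
rewrite {}ay in oa *; rewrite occ_cat (occ_self v0) addn1 in oa.
case: oa => /eqP; rewrite eqn0Ngt -has_count => /hasPn noy.
rewrite -catA occ_cat (@eq_in_count _ _ pred0) ?count_pred0// => i iy.
apply/negbTE/negP => /(prefix_trans pvw) vi; have := noy _ iy => /negP; apply.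
move: iy vi; rewrite mem_iota => /andP[_ iy].
by rewrite catA drop_cat size_cat ltn_addr// prefix_catW// size_drop size_cat; lia.
Qed.

Lemma langR_fallback v w : fallback v w ->
  langR w = [set h | occ w (v ++ h) = 0%N].
Proof.
move=> fvw; apply/seteqP; split=> h; rewrite /langR/= (occ_fallback _ fvw).
  by case.
by move->.
Qed.

Lemma langG_fallback v w : fallback v w ->
  langG w = [set h | occ w (v ++ h) = 1%N /\ suffix w (v ++ h)].
Proof.
move=> fvw; have [_ _ svw _] := fvw.
have sv h : suffix (v ++ h) (w ++ h) by rewrite suffix_catl// eqxx.
apply/seteqP; split=> h; rewrite /langG/= (occ_fallback _ fvw).
  move=> [[e1] sw]; split=> //; apply: suffix_sub sw (sv h) _.
  by rewrite leqNgt; apply/negP => /occ_size; rewrite e1.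
by move=> [-> sw]; split=> //; exact: suffix_trans (sv h).
Qed.

Lemma langG_suffix v c w g : fallback v w -> w = v ++ c -> langG w g ->
  suffix c g.
Proof.
move=> fvw wc; rewrite (langG_fallback fvw) => -[_ sw].
have sc : suffix c (v ++ g) by apply: suffix_trans sw; rewrite wc suffix_suffix.
apply: suffix_sub sc (suffix_suffix v g) _.
by have := size_suffix sw; rewrite wc !size_cat leq_add2l.
Qed.

Lemma langG_shortest v c w : fallback v w -> w = v ++ c -> langG w c.
Proof.
move=> fvw wc; rewrite (langG_fallback fvw)/= -wc suffix_refl occ_self//.
by move=> w0; case: fvw; rewrite w0.
Qed.

Lemma occ_ge2 v g : v <> [::] -> prefix v g -> suffix v g -> g <> v ->
  (2 <= occ v g)%N.
Proof.
move=> v0 pvg /suffixP[z gz] gv; rewrite [in occ _ _]gz occ_cat occ_self// addn1.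
rewrite ltnS -has_count; apply/hasP; exists 0%N; last by rewrite drop0 -gz.
by rewrite mem_iota; case: z gz gv => // ->.
Qed.

Lemma first_occ v y : v <> [::] -> (0 < occ v y)%N ->
  exists a h, y = a ++ h /\ langL v a.
Proof.
move=> v0 /occ_gt0P vy.
have {}vy : exists i, (i <= size y)%N && prefix v (drop i y).
  by case: vy => i iy vi; exists i; rewrite iy vi.
case: (ex_minnP vy) => i /andP[iy /prefixP[h dy]] imin.
exists (take i y ++ v), h; rewrite -catA -dy cat_take_drop; split=> //.
split; last exact: suffix_suffix.
rewrite occ_cat occ_self// (@eq_in_count _ _ pred0) ?count_pred0// => j.
rewrite mem_iota => /andP[_]; rewrite add0n size_takel// => ji.
apply/negbTE/negP => vj; suff jy : (j <= size y)%N && prefix v (drop j y).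
  by have := imin _ jy; rewrite leqNgt ji.
rewrite (leq_trans (ltnW ji))//=.
rewrite -(cat_take_drop i y) dy catA drop_cat size_cat size_takel//.
by rewrite ltn_addr//; exact: prefix_catl.
Qed.

Lemma first_occ_uniq v a1 a2 h1 h2 : v <> [::] -> langL v a1 -> langL v a2 ->
  a1 ++ h1 = a2 ++ h2 -> a1 = a2 /\ h1 = h2.
Proof.
move=> v0; wlog sz : a1 a2 h1 h2 / (size a1 <= size a2)%N => [H l1 l2 e|].
  have [/H|/ltnW/H] := leqP (size a1) (size a2); first exact.
  by move=> /(_ h2 h1 l2 l1 (esym e))[].
move=> [_ /suffixP[y ay]] [e2 s2] e.
have /prefixP[k a2k] : prefix a1 a2.
  apply: (@prefix_sub _ _ (a1 ++ h1)) => //; first exact: prefix_prefix.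
  by rewrite e prefix_prefix.
have k0 : k = [::].
  apply: contra_eqP e2 => kN0; rewrite gtn_eqF// a2k ay -catA occ_cat.
  apply: leq_trans (leq_addl _ _); apply: occ_ge2 => //.
  - exact: prefix_prefix.
  - apply: suffix_sub s2 _ _; last by rewrite size_cat leq_addr.
    by rewrite a2k ay -catA suffix_suffix.
  - by move=> /(congr1 size); rewrite size_cat; case: k kN0 {a2k} => //= ? ?; lia.
have {}a2k : a1 = a2 by rewrite a2k k0 cats0.
by split=> //; move: e; rewrite a2k => /eqP; rewrite eqseq_cat// eqxx => /eqP.
Qed.

(** An occurrence that starts in [z] and runs past its end would overlap the final [w], and the
    overlap would be a border. All the other occurrences therefore lie inside [z]. *)
Lemma occ_cat_unbordered w z : w <> [::] -> ~ bordered w ->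
  occ w (z ++ w) = (occ w z).+1.
Proof.
move=> w0 ub; rewrite occ_cat occ_self// addn1; congr S.
rewrite /occ -addn1 iotaD count_cat add0n /= drop_size prefixs0.
rewrite (introF eqP w0) /= [RHS]addn0; apply: eq_in_count => i; rewrite mem_iota.
move=> /andP[_ iz]; rewrite drop_cat; case: ifP => [_|]; last by rewrite iz.
have [|wk] := leqP (size w) (size (drop i z)); first exact: prefix_catW.
rewrite [RHS](_ : _ = false); last first.
  by apply/negbTE/negP => /size_prefix; rewrite leqNgt wk.
apply/negbTE/negP; set k := drop i z in wk * => pw; case: ub.
have /prefixP[m wm] : prefix k w.
  by apply: prefix_sub (prefix_prefix k w) pw _; exact: ltnW.
have k0 : (0 < size k)%N by rewrite size_drop; lia.
have sw : size w = (size k + size m)%N by rewrite {1}wm size_cat.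
exists m; split.
- by move=> m0; rewrite sw m0 addn0 ltnn in wk.
- by move=> mw; move: k0; rewrite lt0n -(eqn_add2r (size m)) -sw mw add0n eqxx.
- by move: pw; rewrite {1}wm prefix_catr// eqxx.
- by rewrite wm suffix_suffix.
Qed.

Lemma nval_rcons g d : nval (rcons g d) = (b * nval g + d)%N.
Proof. by rewrite /nval foldl_rcons. Qed.

Lemma nval_cat x y : nval (x ++ y) = (nval x * b ^ size y + nval y)%N.
Proof.
elim/last_ind: y => [|y d IH]; first by rewrite cats0 expn0 muln1 addn0.
by rewrite -rcons_cat !nval_rcons IH size_rcons expnS; lia.
Qed.

Lemma nval1 (d : 'I_b) : nval [:: d] = d. Proof. by rewrite /nval/= muln0. Qed.

Lemma nval_lt g : (nval g < b ^ size g)%N.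
Proof.
elim/last_ind: g => // g d IH; rewrite nval_rcons size_rcons expnS.
by have := ltn_ord d; nia.
Qed.

Lemma nval_ge g : (0 < first_digit g)%N -> (b ^ (size g).-1 <= nval g)%N.
Proof.
case: g => // d g d0; rewrite -cat1s nval_cat nval1.
by rewrite (leq_trans _ (leq_addr _ _))// leq_pmull.
Qed.

Lemma nval_gt0 g : (0 < b)%N -> (0 < first_digit g)%N -> (0 < nval g)%N.
Proof. by move=> b0 /nval_ge; apply: leq_trans; rewrite expn_gt0 b0. Qed.

Lemma nval_inj_size x y : size x = size y -> nval x = nval y -> x = y.
Proof.
elim/last_ind: x y => [|x d IH] y; first by case: y.
case/lastP: y => [|y e]; rewrite !size_rcons// => -[sxy].
rewrite !nval_rcons => e1; have [ld le] := (ltn_ord d, ltn_ord e).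
have de : d = e.
  apply: ord_inj; have := congr1 (modn^~ b) e1.
  by rewrite ![(b * _)%N]mulnC !modnMDl !modn_small.
rewrite de in e1 *; congr rcons; apply: IH => //.
move/addIn/eqP: e1; rewrite eqn_pmul2l; [by move/eqP|exact: leq_trans ld].
Qed.

Lemma nval_inj x y : (0 < first_digit x)%N -> (0 < first_digit y)%N ->
  nval x = nval y -> x = y.
Proof.
wlog : x y / (size x <= size y)%N => [H x0 y0 e|].
  by have [/H|/ltnW/H] := leqP (size x) (size y); [exact|move=> ->].
move=> xy x0 y0 e; apply: nval_inj_size => //.
apply/eqP; rewrite eqn_leq xy leqNgt; apply/negP => yx.
have b0 : (0 < b)%N by case: x {e xy yx} x0 => // d ? _; case: b d => // -[].
have := leq_trans (nval_ge y0) (eq_leq (esym e)); rewrite leqNgt => /negP; apply.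
by apply: (leq_trans (nval_lt x)); rewrite leq_pexp2l//; lia.
Qed.

Lemma first_digit_cat x y : x <> [::] -> first_digit (x ++ y) = first_digit x.
Proof. by case: x. Qed.

End Words.

(** * Harmonic sums over words *)

Lemma le_esum_image (R : realType) (T T' : choiceType) (A : set T) (B : set T')
    (e : T -> T') (a : T' -> \bar R) : set_inj A e -> e @` A `<=` B ->
  (forall i, B i -> (0 <= a i)%E) ->
  (\esum_(i in A) a (e i) <= \esum_(j in B) a j)%E.
Proof.
move=> ie AB a0; rewrite -esum_image//.
rewrite [leRHS](esumID (e @` A))// setIidr// leeDl//.
by apply: esum_ge0 => i [/a0].
Qed.

Lemma le_esum_subset (R : realType) (T : choiceType) (A B : set T)
    (a : T -> \bar R) : A `<=` B -> (forall i, B i -> (0 <= a i)%E) ->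
  (\esum_(i in A) a i <= \esum_(j in B) a j)%E.
Proof.
by move=> AB a0; apply: (@le_esum_image _ _ _ _ _ id) => //; rewrite image_id.
Qed.

(** * Finite mass of the words that avoid a block *)

Section Kempner.
Variables (R : realType) (b : nat).
Hypothesis b1 : (1 < b)%N.
Implicit Types (u v w x y z g h : word b).

Let bR : 0 < b%:R :> R. Proof. by rewrite ltr0n; lia. Qed.

Definition wt x : R := b%:R ^- size x.

Lemma wt_gt0 x : 0 < wt x. Proof. by rewrite invr_gt0 exprn_gt0. Qed.
Lemma wt_ge0 x : 0 <= wt x. Proof. exact/ltW/wt_gt0. Qed.
Lemma wt_cat x y : wt (x ++ y) = wt x * wt y.
Proof. by rewrite /wt size_cat exprD invfM. Qed.
Let wtE0 x : (0 <= (wt x)%:E)%E. Proof. by rewrite lee_fin wt_ge0. Qed.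

Lemma mass_size n : \esum_(x in [set x | size x = n]) (wt x)%:E = 1%E.
Proof.
elim: n => [|n IH].
  rewrite (_ : [set x | _] = [set [::]]).
    by rewrite esum_set1// /wt expr0 invr1.
  by apply/seteqP; split=> x /=; [case: x|move=> ->].
rewrite (reindex_esum ([set: 'I_b] `*` [set x | size x = n]) _
  (fun k => k.1 :: k.2)); last first.
  split=> [[d x] [_ /= <-]//|[d x] [e y] _ _ /= [-> ->]//|[//|d x] /= [sx]].
  by exists (d, x).
rewrite -(@esum_esum _ _ _ setT (fun=> [set x | size x = n])
  (fun d x => (wt (d :: x))%:E))//.
under eq_esum => d _.
  under eq_esum => x _ do rewrite -cat1s wt_cat EFinM.
  rewrite esumZl//; last exact: wt_ge0.
  rewrite IH mule1 /wt expr1.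
  over.
rewrite (_ : [set: 'I_b] = [set` enum 'I_b]); last first.
  by apply/seteqP; split=> // d _ /=; rewrite mem_enum.
rewrite esum_fset; [|exact: finite_seq|by move=> i _; rewrite lee_fin invr_ge0 ltW].
rewrite -fsbig_seq ?enum_uniq// sumEFin big_enum sumr_const card_ord.
by rewrite -[X in X *+ _]mul1r -mulrnAl mulfV// gt_eqF.
Qed.

Lemma mass_size_neq u : \esum_(x in [set x | size x = size u /\ x <> u])
  (wt x)%:E = (1 - wt u)%:E.
Proof.
have := mass_size (size u); rewrite (esumID [set u])//.
rewrite setIidr => [|x -> //]; rewrite esum_set1//.
rewrite (_ : _ `&` _ = [set x | size x = size u /\ x <> u]) => [|//].
by rewrite EFinB => <-; rewrite addeAC subee// add0e.
Qed.

Lemma mass_size_lt n : \esum_(x in [set x | (size x < n)%N]) (wt x)%:E = n%:R%:E.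
Proof.
elim: n => [|n IH].
  by rewrite (_ : [set x | _] = set0) ?esum_set0//; apply/seteqP; split.
rewrite (esumID [set x | (size x < n)%N])// setIidr; last first.
  by move=> x /= /ltnW.
rewrite IH (_ : _ `&` _ = [set x | size x = n]) ?mass_size -?EFinD ?natr1//.
apply/seteqP; split=> x /=; rewrite ltnS leq_eqVlt.
  by move=> [/orP[/eqP//|->]].
by move=> ->; rewrite eqxx ltnn.
Qed.

(* Cutting [z] after its first [size u] letters leaves at most
   [1 - b^-|u|] times the mass of the words shorter by [size u]. *)
Lemma esum_avoid_trunc u k : u <> [::] ->
  (\esum_(z in [set z | occ u z = 0%N /\ (size z < k * size u)%N]) (wt z)%:E
   <= ((size u)%:R * b%:R ^+ size u)%:E)%E.
Proof.
move=> u0; elim: k => [|k IH].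
  rewrite (_ : [set z | _] = set0) ?esum_set0 ?lee_fin ?mulr_ge0 ?exprn_ge0//.
  by apply/seteqP; split => // z [].
rewrite (esumID [set z | (size z < size u)%N])//.
(* The bound is the fixed point of E = |u| + (1 - b^-|u|) E: the words shorter than [u] have mass
   |u|, and the others are cut after |u| letters. *)
apply: (@le_trans _ _ ((size u)%:R%:E + (1 - wt u)%:E *
    ((size u)%:R * b%:R ^+ size u)%:E)%E); last first.
  have bu : b%:R ^+ size u != 0 :> R by rewrite expf_neq0// gt_eqF.
  by rewrite -EFinM -EFinD mulrBl mul1r mulrCA mulVf// mulr1 addrC subrK.
apply: leeD.
  rewrite -mass_size_lt; apply: le_esum_subset => [z []//|z _].
  exact: wtE0.
pose X := [set x | size x = size u /\ x <> u].
pose Y := [set z | occ u z = 0%N /\ (size z < k * size u)%N].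
rewrite [leLHS](eq_esum (b := fun z => (wt (take (size u) z))%:E *
    (wt (drop (size u) z))%:E)%E); last first.
  by move=> z _; rewrite -EFinM -wt_cat cat_take_drop.
apply: (@le_trans _ _ (\esum_(p in X `*` Y) ((wt p.1)%:E * (wt p.2)%:E))%E).
  apply: (@le_esum_image _ _ _ _ _ (fun z => (take (size u) z, drop (size u) z))
    (fun p => (wt p.1)%:E * (wt p.2)%:E)%E).
  - move=> z1 z2 _ _ [e1 e2].
    by rewrite -(cat_take_drop (size u) z1) e1 e2 cat_take_drop.
  - move=> _ [z [[oz szk] /negP szu] <-]; rewrite -leqNgt in szu; split=> /=.
      split=> [|e]; first by rewrite size_takel.
      have := occ_eq0 oz (leq0n _); rewrite drop0.
      by rewrite -(cat_take_drop (size u) z) e prefix_prefix.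
    split; last by rewrite size_drop ltn_subLR// -mulSn.
    move: oz; rewrite -{1}(cat_take_drop (size u) z) occ_cat => /eqP.
    by rewrite addn_eq0 => /andP[_ /eqP].
  - by move=> p _; exact: mule_ge0.
rewrite -(@esum_esum _ _ _ X (fun=> Y) (fun x y => (wt x)%:E * (wt y)%:E)%E).
  under eq_esum do rewrite esumZl ?wt_ge0//.
  under eq_esum do rewrite muleC.
  set E := esum Y _; have E0 : (0 <= E)%E by exact: esum_ge0.
  have Ef : E \is a fin_num.
    by rewrite ge0_fin_numE// (le_lt_trans IH)// ltry.
  rewrite -(fineK Ef) esumZl//; last exact: fine_ge0.
  rewrite mass_size_neq fineK// muleC lee_wpmul2l//.
  by rewrite lee_fin subr_ge0 invf_le1 ?exprn_gt0// exprn_ege1// ler1n; lia.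
by move=> *; exact: mule_ge0.
Qed.

(** A finite set of words has bounded length, so the truncated bound, which is uniform in [k],
    passes to the supremum over finite subsums. *)
Lemma absum_avoid u : u <> [::] -> absum [set z | occ u z = 0%N] wt.
Proof.
move=> u0; apply: absum_ge0 => [z _|]; first exact: wt_ge0.
apply: (@le_lt_trans _ _ ((size u)%:R * b%:R ^+ size u)%:E); last exact: ltry.
apply: ge_ereal_sup => _ [X [fX XA]] <-.
pose k := (\max_(z <- finmap.enum_fset (fset_set X)) size z).+1.
apply: le_trans (esum_avoid_trunc k u0); apply: esum_ge; exists X => //.
split=> // z Xz; split; first exact: XA.
have : (size z < k)%N.
  by rewrite ltnS; apply: leq_bigmax_seq => //; rewrite in_fset_set// inE.
by case: u u0 {XA} => //= d u _; nia.
Qed.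

End Kempner.

Lemma catIs (T : Type) (s s1 s2 : seq T) : s1 ++ s = s2 ++ s -> s1 = s2.
Proof.
move=> e; have sz : size s1 = size s2.
  by have := congr1 size e; rewrite !size_cat => /addIn.
by have := congr1 (take (size s1)) e; rewrite take_size_cat// sz take_size_cat.
Qed.

(** * Factorisations of words and the resulting identities between sums *)

Section LanguageSums.
Variables (R : realType) (b : nat).
Hypothesis b1 : (1 < b)%N.
Implicit Types (u v w x y z g h : word b).

Definition headed (A : set (word b)) : set (word b) :=
  [set g | A g /\ (0 < first_digit g)%N].

Definition avoid u : set (word b) := [set z | occ u z = 0%N].

Lemma avoid_cat u x y : occ u (x ++ y) = 0%N -> occ u x = 0%N /\ occ u y = 0%N.
Proof.
rewrite occ_cat => /eqP; rewrite addn_eq0 => /andP[xy0 /eqP y0]; split=> //.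
have [u0|u0] := eqVneq u [::].
  by have := @occ_gt0 _ u y 0 (leq0n _); rewrite {1}u0 prefix0s y0 => /(_ isT).
apply/eqP; rewrite eqn0Ngt; apply/negP => /occ_gt0P[i]; rewrite leq_eqVlt.
move=> /orP[/eqP->|ix]; first by rewrite drop_size prefixs0 (negbTE u0).
move=> ui; move: xy0; rewrite eqn0Ngt -has_count => /hasPn /(_ i).
by rewrite mem_iota ix drop_cat ix prefix_catl// => /(_ isT).
Qed.

Lemma langL_strip u l : u <> [::] -> langL u l ->
  exists2 z, l = z ++ u & avoid u z.
Proof.
move=> u0 [ol /suffixP[z lz]]; exists z => //.
move: ol; rewrite lz occ_cat occ_self// addn1 => -[] /eqP.
rewrite eqn0Ngt -has_count => /hasPn zu.
apply/eqP; rewrite eqn0Ngt; apply/negP => /occ_gt0P[i]; rewrite leq_eqVlt.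
move=> /orP[/eqP->|iz]; first by rewrite drop_size prefixs0 (introF eqP u0).
move=> ui; have := zu i; rewrite mem_iota iz drop_cat iz prefix_catl//.
by move=> /(_ isT).
Qed.

Lemma langR_avoid w : w <> [::] -> langR w `<=` avoid w.
Proof.
move=> w0 h; rewrite /langR /avoid/= occ_cat; set k := count _ _ => kh.
have k0 : (0 < k)%N.
  rewrite -has_count; apply/hasP; exists 0%N; last by rewrite drop0 prefix_prefix.
  by rewrite mem_iota; case: (w) w0.
by apply/eqP; rewrite -leqn0 -(leq_add2l k) kh addn0.
Qed.

Lemma absum_langR w : w <> [::] -> absum (langR w) (@wt R b).
Proof.
move=> w0; have := absum_avoid R b1 w0; apply: le_lt_trans.
by apply: le_esum_subset => [|z _]; [exact: langR_avoid|rewrite lee_fin].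
Qed.

Lemma nval_inv_le g : (0 < first_digit g)%N ->
  (nval g)%:R^-1 <= b%:R * wt R g :> R.
Proof.
move=> g0; have gs : (0 < size g)%N by case: g g0.
have bR : 0 < b%:R :> R by rewrite ltr0n; lia.
rewrite /wt -[in leRHS](prednK gs) exprS invfM mulVKf ?gt_eqF//.
rewrite lef_pV2 ?posrE ?exprn_gt0// ?ltr0n ?nval_gt0//; last lia.
by rewrite -natrX ler_nat nval_ge.
Qed.

Lemma absum_headed A : absum A (@wt R b) ->
  absum (headed A) (fun g => (nval g)%:R^-1 : R).
Proof.
move=> Aw; apply: (absum_le (g := fun g => b%:R * wt R g)).
  by move=> g [_ g0]; rewrite ger0_norm ?invr_ge0// nval_inv_le.
apply: absumZ; apply: le_lt_trans Aw; apply: le_esum_subset => [g []//|g _].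
by rewrite lee_fin.
Qed.

(** Removing the terminal [u] injects [langL u] into the words that avoid [u] and does not decrease
    the weight. *)
Lemma absum_langL u : u <> [::] -> absum (langL u) (@wt R b).
Proof.
move=> u0; have := absum_avoid R b1 u0; apply: le_lt_trans.
apply: (@le_trans _ _ (\esum_(l in langL u)
  `|wt R (take (size l - size u) l)|%:E)%E).
  apply: le_esum => l /(langL_strip u0)[z -> _].
  rewrite size_cat addnK take_size_cat// wt_cat lee_fin.
  rewrite !ger0_norm ?mulr_ge0 ?wt_ge0// ler_piMr ?wt_ge0//.
  by rewrite invf_le1 ?exprn_gt0 ?ltr0n ?exprn_ege1 ?ler1n//; lia.
apply: (le_esum_image (e := fun l => take (size l - size u) l)
  (a := fun z => `|wt R z|%:E)).
- move=> l1 l2; rewrite !inE => /(langL_strip u0)[z1 -> _].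
  move=> /(langL_strip u0)[z2 -> _].
  by rewrite !size_cat !addnK !take_size_cat// => ->.
- move=> _ [l /(langL_strip u0)[z -> z0] <-].
  by rewrite size_cat addnK take_size_cat.
- by move=> z _; rewrite lee_fin.
Qed.

Lemma IharmE u : Iharm R u 0 =
  \esum_(z in headed (avoid u)) ((nval z)%:R^-1)%:E.
Proof.
rewrite /Iharm; apply: (reindex_esum _ _ (@nval b)); split.
- by move=> z [oz z0]; split; [apply: nval_gt0 => //; lia|exists z].
- by move=> x y; rewrite !inE => -[_ x0] [_ y0]; exact: nval_inj.
- by move=> n [n0 [g [gn g0 og]]]; exists g.
Qed.

(** A word that avoids [w] and contains [v] is cut after its first [v] into [a ++ h]; by
    [occ_first], avoiding [w] then depends on [v ++ h] only, that is, on [h] being in [langR w]. *)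
Lemma esum_avoid_split v w (F : word b -> R) : fallback v w -> v <> [::] ->
  (forall z, 0 <= F z) ->
  (\esum_(z in headed (avoid w)) (F z)%:E =
   \esum_(z in headed (avoid v)) (F z)%:E +
   \esum_(a in headed (langL v)) \esum_(h in langR w) (F (a ++ h))%:E)%E.
Proof.
move=> fvw v0 F0; rewrite (esumID (headed (avoid v))); last first.
  by move=> z _; rewrite lee_fin.
congr (_ + _)%E.
  congr (esum _ _); apply/seteqP; split=> [z []//|z [oz z0]]; split=> //.
  split=> //; apply/eqP; rewrite eqn0Ngt; apply/negP => /occ_gt0P[i iz wi].
  case: fvw => _ pvw _ _.
  by have := occ_eq0 oz iz; rewrite (prefix_trans pvw wi).
rewrite esum_esum; last by move=> *; rewrite lee_fin.
apply: reindex_esum; split.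
- move=> [a h] [/= [la a0] Rh].
  have aN0 : a <> [::] by move=> a_eq; rewrite a_eq in a0.
  split; first split.
  + rewrite /avoid/= (occ_first _ fvw)//.
    by move: Rh; rewrite (langR_fallback fvw).
  + by rewrite first_digit_cat.
  + move=> -[/avoid_cat[]]; case: la => -> //.
- move=> [a1 h1] [a2 h2]; rewrite !inE => -[[/= l1 _] _] [[/= l2 _] _] e.
  by have [-> ->] := first_occ_uniq v0 l1 l2 e.
- move=> y [[wy y0] vy].
  have oy : (0 < occ v y)%N by rewrite lt0n; apply/eqP => oy; apply: vy.
  have [a [h [yah la]]] := first_occ v0 oy.
  have aN0 : a <> [::].
    by move=> a0; case: la => _; rewrite a0 suffixs0 => /eqP.
  exists (a, h) => //=; split=> /=.
    by split=> //; rewrite -(first_digit_cat h aN0) -yah.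
  by rewrite (langR_fallback fvw)/= -(occ_first _ fvw v0 la) -yah.
Qed.

Lemma esum_langL_bordered v w (F : word b -> R) : fallback v w -> v <> [::] ->
  (forall z, 0 <= F z) ->
  (\esum_(z in headed (langL w)) (F z)%:E =
   \esum_(a in headed (langL v)) \esum_(g in langG w) (F (a ++ g))%:E)%E.
Proof.
move=> fvw v0 F0.
rewrite esum_esum; last by move=> *; rewrite lee_fin.
have sva a h : langL v a -> suffix (v ++ h) (a ++ h).
  by move=> [_ sva]; rewrite suffix_catl// eqxx.
apply: reindex_esum; split.
- move=> [a h] [/= [la a0]]; rewrite (langG_fallback fvw) => -[oh sh].
  have aN0 : a <> [::] by move=> a_eq; rewrite a_eq in a0.
  split; last by rewrite first_digit_cat.
  split; first by rewrite (occ_first _ fvw).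
  by apply: suffix_trans sh (sva _ _ _).
- move=> [a1 h1] [a2 h2]; rewrite !inE => -[[/= l1 _] _] [[/= l2 _] _] e.
  by have [-> ->] := first_occ_uniq v0 l1 l2 e.
- move=> y [[wy sy] y0].
  have oy : (0 < occ v y)%N.
    have /occ_gt0P[i iy wi] : (0 < occ w y)%N by rewrite wy.
    case: fvw => _ pvw _ _; apply: occ_gt0 iy _; exact: prefix_trans wi.
  have [a [h [yah la]]] := first_occ v0 oy.
  have aN0 : a <> [::].
    by move=> a0; case: la => _; rewrite a0 suffixs0 => /eqP.
  exists (a, h) => //=; split=> /=.
    by split=> //; rewrite -(first_digit_cat h aN0) -yah.
  have oh : occ w (v ++ h) = 1%N by rewrite -(occ_first _ fvw v0 la) -yah.
  rewrite (langG_fallback fvw); split=> //.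
  apply: suffix_sub (sva a h la) _; first by rewrite -yah.
  by rewrite leqNgt; apply/negP => /occ_size; rewrite oh.
Qed.

Lemma langR_langG_bij w : w <> [::] -> ~ bordered w ->
  set_bij (langR w) (langG w) (cat^~ w).
Proof.
move=> w0 ub; have fw := fallback_unbordered w0 ub; split.
- move=> h; rewrite (langR_fallback fw) (langG_fallback fw) /= => oh.
  by rewrite occ_cat_unbordered// oh suffix_suffix.
- by move=> h1 h2 _ _; exact: (@catIs _ w).
- move=> g; rewrite (langG_fallback fw) /= => -[og /suffixP[h gh]].
  exists h => //; rewrite (langR_fallback fw)/=.
  by move: og; rewrite gh occ_cat_unbordered// => -[].
Qed.

(** Because the first digit of [w] is 0, [w] itself is not headed: the prefix [z] is non-empty and
    carries the non-zero first digit. *)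
Lemma esum_langL_unbordered w (F : word b -> \bar R) : w <> [::] ->
  ~ bordered w -> first_digit w = 0%N ->
  \esum_(l in headed (langL w)) F l = \esum_(z in headed (avoid w)) F (z ++ w).
Proof.
move=> w0 ub w1; apply: reindex_esum; split.
- move=> z [oz z0]; have zN0 : z <> [::] by move=> z_eq; rewrite z_eq in z0.
  split; last by rewrite first_digit_cat.
  by split; [rewrite occ_cat_unbordered// oz|exact: suffix_suffix].
- by move=> h1 h2 _ _; exact: (@catIs _ w).
- move=> l [/(langL_strip w0)[z -> oz] l0]; exists z => //; split=> //.
  by case: z l0 {oz} => //=; rewrite w1.
Qed.

End LanguageSums.

(** * Stationary measures *)

Section CountableSums.
Variable R : realType.

(** Turns unordered sums over a countable type into series over the integers, to which monotone
    convergence applies; codes without a preimage in [A] contribute 0. *)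
Lemma esum_pickle (T : countType) (A : set T) (a : T -> \bar R) :
  (forall t, A t -> (0 <= a t)%E) ->
  \esum_(t in A) a t =
  (\sum_(n <oo) if @pickle_inv T n is Some t then
                  if t \in A then a t else 0 else 0)%E.
Proof.
move=> a0; pose F n : \bar R := if @pickle_inv T n is Some t then
  if t \in A then a t else 0%E else 0%E.
rewrite -[RHS]/(\sum_(n <oo) F n)%E.
have F0 n : (0 <= F n)%E.
  rewrite /F; case: (@pickle_inv T n) => // t; case: ifPn => // /set_mem.
  exact: a0.
rewrite nneseries_esumT// (esumID (range (@pickle T)))//.
rewrite setTI esum_image; last by move=> x y _ _; exact: (pcan_inj pickleK).
rewrite [X in (_ + X)%E]esum1 ?adde0.
  rewrite esum_mkcond; apply: eq_esum => t _.
  by rewrite /F pickleK_inv.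
move=> n [_ nr]; rewrite /F; case e : pickle_inv => [t|//].
exfalso; apply: nr; exists t => //.
by have := @pickle_invK T n; rewrite /ocancel e.
Qed.

Context d (X : measurableType d).

Lemma ge0_integral_esum_measure (T : countType) (A : set T)
    (M : {measure set X -> \bar R}) (m : T -> {measure set X -> \bar R})
    (D : set X) (f : X -> \bar R) :
  (forall B, measurable B -> M B = \esum_(t in A) m t B) ->
  measurable D -> measurable_fun D f -> (forall x, D x -> (0 <= f x)%E) ->
  (\int[M]_(x in D) f x = \esum_(t in A) \int[m t]_(x in D) f x)%E.
Proof.
move=> MA mD mf f0.
pose m' n : {measure set X -> \bar R} := if @pickle_inv T n is Some t then
  if t \in A then m t else mzero else mzero.
rewrite (@eq_measure_integral _ _ _ _ (mseries m' 0)); last first.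
  move=> B mB _; rewrite [LHS]MA// esum_pickle//= /mseries.
  by apply: eq_eseriesr => n _; rewrite /m'; case: (@pickle_inv T n) => // t; case: ifP.
rewrite ge0_integral_measure_series// esum_pickle; last first.
  by move=> t _; exact: integral_ge0.
apply: eq_eseriesr => n _; rewrite /m'.
by case: (@pickle_inv T n) => [t|]; [case: ifP => // _|]; rewrite integral_measure_zero.
Qed.

Lemma ge0_integral_esum (T : countType) (A : set T)
    (M : {measure set X -> \bar R}) (D : set X) (f : T -> X -> \bar R) :
  measurable D -> (forall t, A t -> measurable_fun D (f t)) ->
  (forall t x, A t -> D x -> (0 <= f t x)%E) ->
  (\int[M]_(x in D) (\esum_(t in A) f t x) =
   \esum_(t in A) \int[M]_(x in D) f t x)%E.
Proof.
move=> mD mf f0; rewrite esum_pickle; last first.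
  by move=> t At; apply: integral_ge0 => x; exact: f0.
under eq_integral => x /set_mem Dx.
  rewrite esum_pickle; last by move=> t At; exact: f0.
  over.
rewrite integral_nneseries//.
- apply: eq_eseriesr => n _; case: (@pickle_inv T n) => [t|]; last by rewrite integral0.
  by case: (boolP (t \in A)) => // _; rewrite integral0.
- move=> n; case: (@pickle_inv T n) => [t|//].
  by case: (boolP (t \in A)) => [/set_mem /mf//|_].
- move=> n x Dx; case: (@pickle_inv T n) => [t|//].
  by case: ifPn => // /set_mem At; exact: f0.
Qed.

Lemma measurable_fun_esum (T : countType) (A : set T) (D : set X)
    (f : T -> X -> \bar R) : measurable D ->
  (forall t, A t -> measurable_fun D (f t)) ->
  (forall t x, A t -> D x -> (0 <= f t x)%E) ->
  measurable_fun D (fun x => \esum_(t in A) f t x).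
Proof.
move=> mD mf f0.
pose F n x : \bar R := if @pickle_inv T n is Some t then
  if t \in A then f t x else 0%E else 0%E.
apply: (eq_measurable_fun (fun x => (\sum_(n <oo) F n x)%E)).
  by move=> x /set_mem Dx; rewrite esum_pickle// => t At; exact: f0.
apply: ge0_emeasurable_sum => n.
  move=> x Dx _; rewrite /F; case: (@pickle_inv T n) => // t.
  by case: ifPn => // /set_mem At; exact: f0.
move=> _; rewrite /F; case: (@pickle_inv T n) => [t|//].
by case: (boolP (t \in A)) => [/set_mem /mf//|_].
Qed.

End CountableSums.

(** * Integration against a stationary measure *)

Section Stationary.
Variables (R : realType) (b : nat).
Hypothesis b1 : (1 < b)%N.
Implicit Types (w g : word b).

Let I01 : set (measurableTypeR R) := `[0%R, 1%R]%classic.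

Lemma phiE g (t : R) : phi g t = ((nval g)%:R + t) / b%:R ^+ size g.
Proof. by rewrite /phi /xval mulrDl [_^-1 * t]mulrC. Qed.

Lemma xval_itv g : 0 <= xval R g < 1.
Proof.
have b0 : 0 < b%:R ^+ size g :> R by rewrite exprn_gt0// ltr0n; lia.
apply/andP; split; first by rewrite divr_ge0// ltW.
by rewrite /xval ltr_pdivrMr// mul1r -natrX ltr_nat nval_lt.
Qed.

Lemma phi_itv g (t : R) : 0 <= t <= 1 -> 0 <= phi g t <= 1.
Proof.
move=> /andP[t0 t1]; rewrite phiE.
have b0 : 0 < b%:R ^+ size g :> R by rewrite exprn_gt0// ltr0n; lia.
apply/andP; split; first by rewrite divr_ge0 ?addr_ge0// ltW.
rewrite ler_pdivrMr// mul1r.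
have : (nval g)%:R + 1 <= b%:R ^+ size g :> R.
  by rewrite natr1 -natrX ler_nat nval_lt.
lra.
Qed.

Lemma measurable_phi g :
  measurable_fun [set: measurableTypeR R]
    (@phi R b g : measurableTypeR R -> measurableTypeR R).
Proof. by apply: measurable_funD => //; apply: measurable_funM. Qed.

Variables (w : word b) (j : nat) (nu : probability (measurableTypeR R) R).
Hypothesis nuS : stationary w j nu.

Lemma stationary_lambda :
  (\esum_(g in langG w) (b%:R ^- (j * size g) : R)%:E)%E = (lambda R w j)%:E.
Proof.
have [_ /(_ setT measurableT)] := nuS.
rewrite probability_setT mule1 => <-; apply: eq_esum => g _.
by rewrite /pushforward preimage_setT probability_setT mule1.
Qed.

Lemma lambda_ge0 i : 0 <= lambda R w i.
Proof.
by apply/fine_ge0/esum_ge0 => g _; rewrite lee_fin invr_ge0 exprn_ge0.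
Qed.

Lemma stationary_integral (f : measurableTypeR R -> \bar R) :
  measurable_fun I01 f -> (forall x, I01 x -> (0 <= f x)%E) ->
  ((lambda R w j)%:E * \int[nu]_(x in I01) f x =
   \esum_(g in langG w) (b%:R ^- (j * size g))%:E *
     \int[nu]_(x in I01) f (phi g x))%E.
Proof.
move=> mf f0; have mI : measurable I01 by exact: measurable_itv.
have c0 g : 0 <= b%:R ^- (j * size g) :> R by rewrite invr_ge0 exprn_ge0.
have nuC : nu (~` I01) = 0%E.
  by rewrite probability_setC// (nuS.1 : nu I01 = 1%E) subee.
rewrite -(@ge0_integral_mscale _ _ _ _ _ mI (NngNum (lambda_ge0 j)) _ mf)//.
pose m g : {measure set (measurableTypeR R) -> \bar R} :=
  mscale (NngNum (c0 g))
   (measure_function_pushforward__canonical__measure_function_Measure nu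
     (measurable_phi g)).
rewrite (@ge0_integral_esum_measure _ _ _ _ (langG w) _ m)//; last first.
  by move=> B mB; rewrite /= /mscale/= -(nuS.2 _ mB).
apply: eq_esum => g _; rewrite ge0_integral_mscale//; congr (_ * _)%E.
rewrite ge0_integral_pushforward//; [|exact: measurable_phi|]; last first.
  by move=> x /set_mem /f0.
have mIg : measurable (@phi R b g @^-1` I01).
  by rewrite -[X in measurable X]setTI; exact: measurable_phi.
(* The preimage of [0, 1] by [phi g] contains [0, 1] and may be larger, but the excess is negligible
   because [nu] is carried by [0, 1]. *)
rewrite (@ge0_negligible_integral _ _ _ _ _ (~` I01))//.
- congr (integral _ _ _); rewrite setDE setCK; apply/setIidPr => x.
  by rewrite /I01 /preimage/= !in_itv/=; exact: phi_itv.
- exact: measurableC.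
- apply: (measurable_comp mI) => //; first by move=> _ [x Ix <-].
  exact: measurable_funS (measurable_phi g).
- by move=> x /f0.
Qed.

End Stationary.

(** * Eigenfunctions and duality *)

Section Polynomials.
Variable R : realType.
Implicit Types p r : {poly R}.

Lemma binD_fact m n : ('C(m + n, m) * (m`! * n`!) = (m + n)`!)%N.
Proof. by rewrite -{2}(addKn m n) bin_fact// leq_addr. Qed.

Lemma mul_binD i h k :
  ('C(h + k, h) * 'C(i + (h + k), i) = 'C(i + h + k, i + h) * 'C(i + h, i))%N.
Proof.
apply/eqP; have f0 : (0 < i`! * (h`! * k`!))%N by rewrite !muln_gt0 !fact_gt0.
rewrite -(eqn_pmul2r f0); apply/eqP; transitivity (i + h + k)`!.
  by rewrite -addnA -(binD_fact i (h + k)) -(binD_fact h k); ring.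
by rewrite -(binD_fact (i + h) k) -(binD_fact i h); ring.
Qed.

Lemma nderivn_nderivn p i h : p^`N(i)^`N(h) = p^`N(i + h) *+ 'C(i + h, i).
Proof.
apply/polyP => k; rewrite coefMn !coef_nderivn -!mulrnA -mul_binD.
by rewrite addnA [in RHS]mulnC.
Qed.

Lemma poly_ext p r : (forall x, p.[x] = r.[x]) -> p = r.
Proof.
move=> pr; apply/eqP; rewrite -subr_eq0; apply/eqP.
apply: (@roots_geq_poly_eq0 _ _ [seq n%:R | n <- iota 0 (size (p - r))]).
- by apply/allP => x _; rewrite /root hornerD hornerN pr subrr.
- by rewrite map_inj_uniq ?iota_uniq// => m n /eqP; rewrite eqr_nat => /eqP.
- by rewrite size_map size_iota.
Qed.

Lemma poly_bound p (M : R) : 0 <= M ->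
  exists2 C : R, 0 <= C & forall x, `|x| <= M -> `|p.[x]| <= C.
Proof.
move=> M0; exists (\sum_(i < size p) `|p`_i| * M ^+ i).
  by apply: sumr_ge0 => i _; rewrite mulr_ge0 ?exprn_ge0.
move=> x xM; rewrite horner_coef; apply: le_trans (ler_norm_sum _ _ _) _.
apply: ler_sum => i _; rewrite normrM normrX ler_wpM2l//.
by rewrite lerXn2r// nnegrE.
Qed.

End Polynomials.

(** * Divided derivatives of the eigenvalue equation *)

Section Eigen.
Variables (R : realType) (b : nat).
Hypothesis b1 : (1 < b)%N.
Variable w : word b.
Hypothesis wj : forall j : nat, (1 <= j)%N ->
  (\esum_(g in langG w) (b%:R ^- (j * size g) : R)%:E)%E = (lambda R w j)%:E.
Implicit Types (p r : {poly R}) (g : word b).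

Lemma absum_langG j : (1 <= j)%N ->
  absum (langG w) (fun g => b%:R ^- (j * size g) : R).
Proof.
move=> j1; apply: absum_ge0 => [g _|]; first by rewrite invr_ge0 exprn_ge0.
by rewrite wj// ltry.
Qed.

Lemma absum_langG_bounded j (h : word b -> R) (C : R) : (1 <= j)%N ->
  (forall g, `|h g| <= C) ->
  absum (langG w) (fun g => b%:R ^- (j * size g) * h g).
Proof.
move=> j1 hC; apply: (absum_le (g := fun g => C * b%:R ^- (j * size g))).
  move=> g _; rewrite normrM mulrC [X in _ * X]ger0_norm ?invr_ge0 ?exprn_ge0//.
  by rewrite ler_wpM2r ?invr_ge0 ?exprn_ge0.
exact/absumZ/absum_langG.
Qed.

Let xval_le1 g : `|xval R g| <= 1.
Proof. by have /andP[x0 /ltW x1] := xval_itv R b1 g; rewrite ger0_norm. Qed.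

Let S j r := sum_over (langG w) (fun g => b%:R ^- (j * size g) * r.[xval R g]).

(** Taylor's formula at [xval g]: the term of degree h in [x] carries b^-(h|g|), which moves the
    weight from exponent j to j + h. *)
Lemma langG_taylor j r (x : R) : (1 <= j)%N ->
  sum_over (langG w) (fun g => b%:R ^- (j * size g) * r.[phi g x]) =
  \sum_(h < size r) x ^+ h * S (j + h) r^`N(h).
Proof.
move=> j1; have aS h : absum (langG w)
    (fun g => b%:R ^- ((j + h) * size g) * r^`N(h).[xval R g]).
  have [C _ rC] := poly_bound r^`N(h) (ler01 : 0 <= 1 :> R).
  by apply: (@absum_langG_bounded _ _ C) => [|g]; [rewrite ltn_addr|exact/rC/xval_le1].
under [RHS]eq_bigr do rewrite -sum_overZ//.
rewrite -sum_over_sum; last by move=> h; exact: absumZ.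
apply: eq_sum_over => g _; rewrite /phi nderiv_taylor; last exact: mulrC.
rewrite mulr_sumr; apply: eq_bigr => h _.
rewrite exprMn exprVn -exprM mulnDl exprD invfM [(size g * h)%N]mulnC.
by ring.
Qed.

Lemma Kop_coef p (l : R) : (forall x, Kop w (horner p) x = l * p.[x]) ->
  forall h, S h.+1 p^`N(h) = l * p`_h.
Proof.
move=> pK h; have [hp|ph] := ltnP h (size p); last first.
  rewrite nth_default// mulr0 nderivn_poly0// /S.
  under eq_sum_over do rewrite horner0 mulr0.
  by rewrite sum_over_ge0E// esum1.
have e : \poly_(k < size p) S k.+1 p^`N(k) = l *: p.
  apply: poly_ext => x; rewrite hornerZ -pK horner_poly /Kop.
  under [RHS]eq_sum_over => g _ do rewrite -[size g]mul1n.
  by rewrite langG_taylor//; apply: eq_bigr => k _; rewrite mulrC add1n.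
by have := congr1 (fun r : {poly R} => r`_h) e; rewrite coef_poly hp coefZ.
Qed.

(** Formally the i-th divided derivative of the eigenvalue equation. Instead of differentiating an
    infinite sum, [langG_taylor] makes both sides polynomials in [x], whose coefficients [Kop_coef]
    compares. *)
Lemma Kop_nderivn p (l : R) : (forall x, Kop w (horner p) x = l * p.[x]) ->
  forall i x, sum_over (langG w)
    (fun g => b%:R ^- (i.+1 * size g) * p^`N(i).[phi g x]) = l * p^`N(i).[x].
Proof.
move=> pK i x; rewrite langG_taylor// horner_coef mulr_sumr.
apply: eq_bigr => h _; rewrite nderivn_nderivn coef_nderivn.
transitivity (x ^+ h * ('C(i + h, i)%:R * (l * p`_(i + h)))); last first.
  by rewrite -mulr_natr; ring.
rewrite -(Kop_coef pK) /S; congr (_ * _).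
under eq_sum_over => g _ do rewrite hornerMn -[X in _ * X]mulr_natl mulrCA.
rewrite sum_overZ; last first.
  have [C _ rC] := poly_bound p^`N(i + h) (ler01 : 0 <= 1 :> R).
  by apply: (@absum_langG_bounded _ _ C) => // g; exact/rC/xval_le1.
by rewrite addSn.
Qed.

End Eigen.

Section UnitIntegral.
Variables (R : realType) (nu : probability (measurableTypeR R) R).
Let I01 : set (measurableTypeR R) := `[0%R, 1%R]%classic.
Hypothesis nu1 : nu I01 = 1%E.
Implicit Types f : measurableTypeR R -> R.

Let mI : measurable I01. Proof. exact: measurable_itv. Qed.

Lemma bounded_integrable01 f (C : R) : measurable_fun I01 f ->
  (forall x, I01 x -> `|f x| <= C) -> nu.-integrable I01 (EFin \o f).
Proof.
move=> mf fC; apply: measurable_bounded_integrable => //.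
  exact: le_lt_trans (probability_le1 nu mI) (ltry 1).
exists C; split; first by rewrite num_real.
by move=> M CM x Ix; apply: le_trans (fC x Ix) (ltW CM).
Qed.

Lemma Rintegral01_cst (c : R) : \int[nu]_(x in I01) c = c.
Proof.
rewrite Rintegral_cst// -[RHS]mulr1; congr (_ * _).
by rewrite -[RHS]/(fine 1%E); congr fine; exact: nu1.
Qed.

Lemma Rintegral01_bound f (C : R) : measurable_fun I01 f ->
  (forall x, I01 x -> `|f x| <= C) -> `|\int[nu]_(x in I01) f x| <= C.
Proof.
move=> mf fC; have fi := bounded_integrable01 mf fC.
apply: le_trans (le_normr_Rintegral _ _) _ => //.
rewrite -[leRHS]Rintegral01_cst; apply: le_Rintegral => //.
- apply: (@bounded_integrable01 _ C); first exact: measurableT_comp.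
  by move=> x Ix; rewrite normr_id fC.
- by apply: (@bounded_integrable01 _ `|C|) => // x _.
Qed.

Lemma EFin_Rintegral f : nu.-integrable I01 (EFin \o f) ->
  (\int[nu]_(x in I01) f x)%:E = (\int[nu]_(x in I01) (f x)%:E)%E.
Proof. by move=> fi; rewrite /Rintegral fineK// integrable_fin_num. Qed.

Lemma integrable_horner (p : {poly R}) :
  nu.-integrable I01 (EFin \o horner p).
Proof.
have [C _ pC] := poly_bound p (ler01 : 0 <= 1 :> R).
apply: (@bounded_integrable01 _ C); first exact: measurable_poly.
move=> x; rewrite /I01/= in_itv/= => /andP[x0 x1]; apply: pC.
by rewrite ger0_norm.
Qed.

End UnitIntegral.

Section EigenIntegral.
Variables (R : realType) (b : nat).
Hypothesis b1 : (1 < b)%N.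
Variables (w : word b) (j : nat) (nu : probability (measurableTypeR R) R).
Hypothesis nuS : stationary w j nu.
Let I01 : set (measurableTypeR R) := `[0%R, 1%R]%classic.

Let mI : measurable I01. Proof. exact: measurable_itv. Qed.

Let absum_j : absum (langG w) (fun g => b%:R ^- (j * size g) : R).
Proof.
apply: absum_ge0 => [g _|]; first by rewrite invr_ge0 exprn_ge0.
by rewrite (stationary_lambda nuS) ltry.
Qed.

Let phi01 (g : word b) x : I01 x -> I01 (phi g x).
Proof. by rewrite /I01/= !in_itv/=; exact: phi_itv. Qed.

(* Adding a constant makes [r] non-negative on [0, 1], so that the sum over [G]
   and the integral can be exchanged by monotone convergence. *)
Lemma eigen_integral0 (r : measurableTypeR R -> R) (C l : R) :
  measurable_fun setT r -> (forall x, I01 x -> `|r x| <= C) ->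
  (forall x, I01 x ->
    sum_over (langG w) (fun g => b%:R ^- (j * size g) * r (phi g x)) = l * r x) ->
  l != lambda R w j -> \int[nu]_(x in I01) r x = 0.
Proof.
move=> mr rC rK lj; have nu1 := nuS.1.
have mrI : measurable_fun I01 r by exact: measurable_funTS.
have c0 g : 0 <= b%:R ^- (j * size g) :> R by rewrite invr_ge0 exprn_ge0.
have rC0 x : I01 x -> 0 <= r x + C.
  by move=> /rC; rewrite ler_norml => /andP[? _]; lra.
pose f x := (r x + C)%:E.
have mf : measurable_fun I01 f.
  by apply/measurable_EFinP; apply: measurable_funD => //; exact: measurable_cst.
have f0 x : I01 x -> (0 <= f x)%E by move=> Ix; rewrite lee_fin rC0.
have := stationary_integral b1 nuS mf f0.
under eq_esum => g _.
  rewrite -ge0_integralZl_EFin//; first last.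
  - apply: (measurable_comp mI) => //; first by move=> _ [x Ix <-]; exact: phi01.
    exact: measurable_funTS (@measurable_phi R b g).
  - by move=> x Ix; apply: f0; exact: phi01.
  over.
rewrite -ge0_integral_esum//; first last.
- by move=> g x _ Ix; rewrite mule_ge0 ?lee_fin// rC0//; exact: phi01.
- move=> g _; apply: measurable_funeM; apply: (measurable_comp mI) => //.
    by move=> _ [x Ix <-]; exact: phi01.
  exact: measurable_funTS (@measurable_phi R b g).
have ri := @bounded_integrable01 _ nu _ _ mrI rC.
have ci (c : R) : nu.-integrable I01 (EFin \o cst c).
  by apply: (@bounded_integrable01 _ nu (cst c) `|c|) => // x _.
have -> : (\int[nu]_(x in I01)
    (\esum_(g in langG w) ((b%:R ^- (j * size g))%:E * f (phi g x))) =
    \int[nu]_(x in I01) (l * r x + lambda R w j * C)%:E)%E.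
  apply: eq_integral => x /set_mem Ix.
  have aR : absum (langG w) (fun g => b%:R ^- (j * size g) * r (phi g x)).
    apply: (absum_le (g := fun g => C * b%:R ^- (j * size g))).
      move=> g _; rewrite normrM mulrC [X in _ * X]ger0_norm// ler_wpM2r//.
      exact/rC/phi01.
    exact: absumZ.
  have aC : absum (langG w) (fun g => C * b%:R ^- (j * size g)) by exact: absumZ.
  rewrite -(rK x Ix) [lambda R w j * C]mulrC.
  have -> : lambda R w j = sum_over (langG w) (fun g => b%:R ^- (j * size g)).
    by apply: EFin_inj; rewrite sum_overE// (stationary_lambda nuS).
  rewrite -sum_overZ// -sum_overD// sum_overE.
  - by apply: eq_esum => g _; rewrite /f -EFinM mulrDr [C * _]mulrC.
  - move=> g _; rewrite [C * _]mulrC -mulrDr mulr_ge0// rC0//; exact: phi01.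
  - exact: absumD.
have -> : (\int[nu]_(x in I01) f x = (\int[nu]_(x in I01) r x + C)%:E)%E.
  rewrite -[in RHS](@Rintegral01_cst _ _ nu1 C) -RintegralD//; last exact: ci.
  by rewrite EFin_Rintegral//; exact: (integrableD mI ri (ci C)).
have lri : nu.-integrable I01 (EFin \o (fun x => l * r x)).
  exact: (integrableZl mI l ri).
rewrite -EFin_Rintegral; last first.
  exact: (integrableD mI lri (ci (lambda R w j * C))).
rewrite RintegralD//; last exact: ci.
rewrite RintegralZl// (@Rintegral01_cst _ _ nu1) -EFinM => -[].
rewrite mulrDr => /addIr /eqP; rewrite -subr_eq0 -mulrBl mulf_eq0 subr_eq0.
by rewrite eq_sym (negbTE lj) => /eqP.
Qed.

End EigenIntegral.

(** * Right coefficients as sums over R *)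

Section RightModes.
Variables (R : realType) (b : nat).
Hypothesis b1 : (1 < b)%N.
Variable w : word b.
Hypothesis w0 : w <> [::].
Implicit Types p : {poly R}.

Let I0 : set (measurableTypeR R) := `[0%R, 1%R[%classic.

Let ge0_integral_eta0 (f : measurableTypeR R -> R) : measurable_fun I0 f ->
  (forall x, I0 x -> 0 <= f x) ->
  (\int[eta0 w]_(x in I0) (f x)%:E)%E =
  \esum_(g in langR w) (wt R g * f (xval R g))%:E.
Proof.
move=> mf f0; have mI : measurable I0 by exact: measurable_itv.
pose m (g : word b) : {measure set (measurableTypeR R) -> \bar R} :=
  mscale (NngNum (wt_ge0 R b1 g)) (\d_(xval R g : measurableTypeR R)).
rewrite (@ge0_integral_esum_measure _ _ _ _ (langR w) _ m)//.
- apply: eq_esum => g _; rewrite ge0_integral_mscale//; last exact/measurable_EFinP.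
  rewrite integral_dirac//; last exact/measurable_EFinP.
  by rewrite diracE mem_set ?mul1e -?EFinM// /I0/= in_itv/= xval_itv.
- exact/measurable_EFinP.
Qed.

Lemma absum_horner_langR p : absum (langR w) (fun g => wt R g * p.[xval R g]).
Proof.
have [C _ pC] := poly_bound p (ler01 : 0 <= 1 :> R).
apply: (absum_le (g := fun g => C * wt R g)); last exact/absumZ/absum_langR.
move=> g _; rewrite normrM ger0_norm ?wt_ge0// mulrC ler_wpM2r ?wt_ge0// pC//.
by have /andP[x0 x1] := xval_itv R b1 g; rewrite ger0_norm// ltW.
Qed.

Lemma integral_eta0 p : \int[eta0 w]_(x in `[0%R, 1%R[) p.[x] =
  sum_over (langR w) (fun g => wt R g * p.[xval R g]).
Proof.
have mp (f : R -> R) : measurable_fun setT f -> measurable_fun I0 f.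
  exact: measurable_funTS.
have mh : measurable_fun setT (horner p : measurableTypeR R -> R).
  exact: measurable_poly.
have maxE (u x : R) : 0 <= u -> u * Num.max x 0 = Num.max (u * x) 0.
  by move=> u0; rewrite maxr_pMr// mulr0.
have aR := absum_horner_langR p.
rewrite /Rintegral integralE -/I0.
have -> : (\int[eta0 w]_(x in I0) (EFin \o horner p)^\+ x)%E =
    (\int[eta0 w]_(x in I0) (Num.max p.[x] 0)%:E)%E.
  by apply: eq_integral => x _; rewrite funeposE EFin_max.
have -> : (\int[eta0 w]_(x in I0) (EFin \o horner p)^\- x)%E =
    (\int[eta0 w]_(x in I0) (Num.max (- p.[x]) 0)%:E)%E.
  by apply: eq_integral => x _; rewrite funenegE EFin_max.
have max0 (f : R -> R) x : I0 x -> 0 <= Num.max (f x) 0.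
  by rewrite le_max lexx orbT.
have mpos : measurable_fun I0 (fun x : measurableTypeR R => Num.max p.[x] 0).
  by apply: mp; apply: measurable_maxr.
have mneg : measurable_fun I0 (fun x : measurableTypeR R => Num.max (- p.[x]) 0).
  by apply: mp; apply: measurable_maxr => //; exact: measurableT_comp.
rewrite (ge0_integral_eta0 mpos (max0 _)).
rewrite (ge0_integral_eta0 mneg (max0 (fun x => - p.[x]))).
rewrite /sum_over.
have posE : \esum_(g in langR w) (wt R g * Num.max p.[xval R g] 0)%:E =
    \esum_(g in langR w) (Num.max (wt R g * p.[xval R g]) 0)%:E.
  by apply: eq_esum => g _; rewrite maxE ?wt_ge0.
have negE : \esum_(g in langR w) (wt R g * Num.max (- p.[xval R g]) 0)%:E =
    \esum_(g in langR w) (Num.max (- (wt R g * p.[xval R g])) 0)%:E.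
  by apply: eq_esum => g _; rewrite maxE ?wt_ge0// mulrN.
have fin (f : word b -> R) :
  absum (langR w) f -> \esum_(g in langR w) (Num.max (f g) 0)%:E \is a fin_num.
  move=> af; rewrite -sum_overE// => [g _|]; first by rewrite le_max lexx orbT.
  apply: (absum_le (g := fun g => `|f g|)) => [g _|].
    by case: (leP (f g) 0) => _; rewrite ?normr0.
  by rewrite /absum; under eq_esum do rewrite normr_id.
have aN : absum (langR w) (fun g => - (wt R g * p.[xval R g])).
  by rewrite /absum; under eq_esum do rewrite normrN.
by rewrite posE negE fineB//; exact: fin.
Qed.

(* For unbordered [w], [r ++ w] runs through [G] as [r] runs through [R], and
   [phi (r ++ w)] sends [- nval w] to [xval r]. *)
Lemma integral_eta0_unbordered p l : ~ bordered w ->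
  (forall x : R, Kop w (horner p) x = l * p.[x]) ->
  \int[eta0 w]_(x in `[0%R, 1%R[) p.[x] =
  b%:R ^+ size w * l * p.[- (nval w)%:R].
Proof.
move=> uw /(_ (- (nval w)%:R)).
have b0 n : b%:R ^+ n != 0 :> R by rewrite expf_neq0// pnatr_eq0; lia.
rewrite integral_eta0 /Kop (reindex_sum_over _ (langR_langG_bij w0 uw)).
rewrite (_ : sum_over _ _ = b%:R ^- size w *
    sum_over (langR w) (fun g => wt R g * p.[xval R g])) => [e|].
  by rewrite -mulrA -e mulVKf.
rewrite -sum_overZ; last exact: absum_horner_langR.
apply: eq_sum_over => g _ /=.
rewrite size_cat exprD invfM /wt mulrAC mulrC; congr (_ * (_ * p.[_])).
rewrite phiE nval_cat natrD natrM natrX size_cat exprD addrK /xval.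
by field; rewrite !b0.
Qed.

End RightModes.

(** * Real series and sums of poles *)

Lemma geometric_tail (R : realType) (J N : nat) (th : R) : 0 <= th < 1 ->
  \sum_(k < N) (if (J <= k)%N then th ^+ k else 0) <= th ^+ J / (1 - th).
Proof.
move=> /andP[th0 th1]; have d0 : 0 < 1 - th by lra.
suff e : (1 - th) * \sum_(k < N) (if (J <= k)%N then th ^+ k else 0) =
    if (J <= N)%N then th ^+ J - th ^+ N else 0.
  rewrite ler_pdivlMr// mulrC e; case: ifP => _; last exact: exprn_ge0.
  by rewrite gerBl exprn_ge0.
elim: N => [|N IH].
  by rewrite big_ord0 mulr0 leqn0; case: eqP => // ->; rewrite subrr.
rewrite big_ord_recr/= mulrDr IH; have [JN|NJ] := leqP J N.
  by rewrite (leqW JN) exprS; ring.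
rewrite mulr0 addr0 leq_eqVlt [(J < N.+1)%N]ltnNge NJ orbF.
by case: eqP => // ->; rewrite subrr.
Qed.

Lemma cvg_sum_ord (R : realType) (J : nat) (f : nat -> nat -> R) (l : nat -> R) :
  (forall i, f i @ \oo --> l i) ->
  (fun N => \sum_(i < J) f i N) @ \oo --> \sum_(i < J) l i.
Proof.
move=> fl; elim: J => [|J IH].
  rewrite big_ord0; under eq_fun do rewrite big_ord0.
  exact: cvg_cst.
rewrite big_ord_recr/=; under eq_fun do rewrite big_ord_recr/=.
by apply: cvgD; [exact: IH|exact: fl].
Qed.

(** * The negative binomial series *)

Section NegativeBinomial.
Variable R : realType.
Implicit Types (x y z : R) (i N : nat).

(** Partial sums of the expansion of (1 - x)^-(i+1); for k < i the binomial coefficient vanishes, so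
    the truncated subtraction in the exponent is harmless. *)
Definition negbin_sum i N x : R := \sum_(k < N) 'C(k, i)%:R * x ^+ (k - i).

Lemma negbin_sum_rec i N x :
  (1 - x) * negbin_sum i.+1 N.+1 x = negbin_sum i N x - 'C(N, i.+1)%:R * x ^+ (N - i).
Proof.
elim: N => [|N IH].
  by rewrite /negbin_sum big_ord_recr !big_ord0 /= !bin0n !mul0r addr0 mulr0 subr0.
rewrite /negbin_sum big_ord_recr/= mulrDr -/(negbin_sum i.+1 N.+1 x) IH.
rewrite [in RHS]big_ord_recr/= -/(negbin_sum i N x) subSS binS natrD.
have [iN|Ni] := leqP i N; last first.
  by rewrite (bin_small Ni) (bin_small (leqW Ni)) !(mul0r, addr0, mulr0, subr0).
rewrite subSn// exprS; set y := x ^+ (N - i); by ring.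
Qed.

Lemma negbin_sum_ge0 i N x : 0 <= x -> 0 <= negbin_sum i N x.
Proof. by move=> x0; apply: sumr_ge0 => k _; rewrite mulr_ge0 ?exprn_ge0. Qed.

Lemma negbin_sum_le i N x : 0 <= x < 1 -> negbin_sum i N x <= (1 - x) ^- i.+1.
Proof.
move=> /andP[x0 x1]; have d0 : 0 < 1 - x by lra.
elim: i N => [|i IH] N.
  rewrite expr1 -[leRHS]mul1r ler_pdivlMr// mulrC /negbin_sum.
  under eq_bigr do rewrite bin0 mul1r subn0.
  rewrite -[1 - x]opprB mulNr -subrX1 opprB gerBl exprn_ge0//.
case: N => [|N]; first by rewrite /negbin_sum big_ord0 invr_ge0 exprn_ge0// ltW.
rewrite exprS invfM -ler_pdivrMl ?invr_gt0// invrK negbin_sum_rec.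
apply: le_trans (IH N); rewrite gerBl mulr_ge0 ?exprn_ge0//.
Qed.

(** For z between y and 1, C(N, i) z^(N - i) is one term of a negative binomial sum at z, hence
    bounded, and the remaining factor (y/z)^(N - i) tends to 0. *)
Lemma bin_geometric_cvg0 i y : 0 <= y < 1 ->
  (fun N => 'C(N, i)%:R * y ^+ (N - i)) @ \oo --> (0 : R).
Proof.
move=> /andP[y0 y1]; pose z := (1 + y) / 2.
have z0 : 0 < z by rewrite /z; lra.
have z1 : z < 1 by rewrite /z; lra.
have yz : 0 <= y / z < 1.
  by rewrite divr_ge0 ?(ltW z0)//= ltr_pdivrMr// mul1r /z; lra.
rewrite -(cvg_shiftn i); under eq_fun do rewrite addnK.
apply: (@squeeze_cvgr _ _ _ _ (cst 0) (geometric ((1 - z) ^- i.+1) (y / z))).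
- apply: nearW => N; rewrite mulr_ge0 ?exprn_ge0//=.
  rewrite -[in leLHS](divfK (lt0r_neq0 z0) y) exprMn mulrCA mulrC.
  apply: ler_wpM2r; first by rewrite exprn_ge0//; case/andP: yz.
  apply: le_trans (negbin_sum_le i (N + i).+1 _); last by rewrite (ltW z0).
  rewrite /negbin_sum big_ord_recr/= addnK lerDr.
  by apply: negbin_sum_ge0; exact: ltW.
- exact: cvg_cst.
- by apply: cvg_geometric; case/andP: yz => ? ?; rewrite ger0_norm.
Qed.

(** The convergence has to be uniform in [x], because it is later integrated against a measure.
    Multiplication by 1 - x reduces the order i + 1 to i at the cost of a boundary term that tends
    to 0. *)
Lemma negbin_sum_cvg i y : 0 <= y < 1 -> exists2 e : nat -> R, e @ \oo --> (0 : R) &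
  forall N x, `|x| <= y -> `|(1 - x) ^- i.+1 - negbin_sum i N x| <= e N.
Proof.
move=> y01; have /andP[y0 y1] := y01; have d0 : 0 < 1 - y by lra.
have dx x : `|x| <= y -> 1 - y <= `|1 - x|.
  by move=> xy; apply: le_trans (lerB_dist _ _); rewrite normr1 lerD2l lerN2.
have dx0 x : `|x| <= y -> 1 - x != 0.
  by move=> /dx h; rewrite -normr_gt0; exact: lt_le_trans h.
elim: i => [|i [e ecvg eP]].
  exists (geometric (1 - y)^-1 y) => [|N x xy].
    by apply: cvg_geometric; rewrite ger0_norm.
  rewrite expr1 /negbin_sum; under eq_bigr do rewrite bin0 mul1r subn0.
  have -> : (1 - x)^-1 - \sum_(k < N) x ^+ k = x ^+ N / (1 - x).
    apply: (mulfI (dx0 x xy)); rewrite mulrBr divff ?dx0// mulrCA divff ?dx0//.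
    by rewrite mulr1 -[1 - x in X in _ - X]opprB mulNr -subrX1; ring.
  rewrite normrM normrX normfV mulrC /=.
  apply: ler_pM; rewrite ?invr_ge0 ?exprn_ge0//.
    by rewrite lef_pV2 ?posrE ?dx ?normr_gt0 ?dx0.
  by rewrite lerXn2r ?nnegrE.
(* The recurrence controls only the indices N + 1; at index 0 the sum is empty and the crude bound
   on (1 - x)^-(i+2) is used. *)
exists (fun N => if N is N'.+1 then
    (e N' + 'C(N', i.+1)%:R * y ^+ (N' - i)) / (1 - y) else (1 - y) ^- i.+2).
  have h0 : (fun N => y * ('C(N, i.+1)%:R * y ^+ (N - i.+1))) @ \oo --> (0 : R).
    by rewrite -(mulr0 y); apply: cvgMl_tmp; exact: bin_geometric_cvg0.
  have h1 : (fun N => 'C(N, i.+1)%:R * y ^+ (N - i)) @ \oo --> (0 : R).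
    apply: cvg_trans h0; apply: near_eq_cvg; apply: nearW => N.
    have [Ni|iN] := leqP N i; first by rewrite bin_small// !mul0r mulr0.
    by rewrite mulrCA -exprS subnS prednK// subn_gt0.
  have h2 : (fun N => e N + 'C(N, i.+1)%:R * y ^+ (N - i)) @ \oo --> (0 : R).
    by rewrite -(addr0 0); exact: cvgD.
  have h3 : (fun N => (e N + 'C(N, i.+1)%:R * y ^+ (N - i)) / (1 - y)) @ \oo
      --> (0 : R) by rewrite -(mul0r (1 - y)^-1); exact: cvgMr_tmp h2.
  by rewrite -cvg_shiftS; exact: h3.
case=> [|N] x xy.
  rewrite /negbin_sum big_ord0 subr0 normfV normrX lef_pV2 ?posrE ?exprn_gt0//.
    by rewrite lerXn2r ?nnegrE ?(ltW d0)// dx.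
  by rewrite normr_gt0 dx0.
have Nx : 0 < `|1 - x| by rewrite normr_gt0 dx0.
rewrite ler_pdivlMr// mulrC; apply: le_trans (ler_wpM2r (normr_ge0 _) (dx x xy)) _.
rewrite -normrM mulrBr negbin_sum_rec exprS invfM mulVKf ?dx0//.
rewrite opprB addrCA addrC; apply: le_trans (ler_normD _ _) _.
apply: lerD; first exact: eP.
rewrite normrM normr_nat normrX ler_wpM2l// lerXn2r ?nnegrE//.
Qed.

End NegativeBinomial.

(** Each term is the difference of two consecutive errors, so a geometric error bound yields
    absolute convergence along with the value of the sum. *)
Lemma series_geometric_approx (R : realType) (a : nat -> R) (S K th : R) :
  0 <= th < 1 -> (forall J, `|S - \sum_(i < J) a i| <= K * th ^+ J) ->
  cvgn [normed series a] /\ limn (series a) = S.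
Proof.
move=> /andP[th0 th1] aS.
have K0 : 0 <= K by have := aS 0%N; rewrite expr0 mulr1; exact: le_trans.
split.
  apply: (@series_le_cvg _ _ (geometric (2 * K) th)) => [i|i|i|]; first exact: normr_ge0.
  - by rewrite /= mulr_ge0 ?exprn_ge0// mulr_ge0.
  - rewrite /=; have -> : a i = (S - \sum_(j < i) a j) - (S - \sum_(j < i.+1) a j).
      by rewrite big_ord_recr/=; ring.
    apply: le_trans (ler_normB _ _) _; have h := exprn_ge0 i th0.
    have := aS i; have := aS i.+1; rewrite exprS /=.
    have : K * (th * th ^+ i) <= K * th ^+ i by rewrite ler_wpM2l// ler_piMl// ltW.
    lra.
  - by apply: is_cvg_geometric_series; rewrite ger0_norm.
apply/cvg_lim => //; apply/cvgrPdist_le => e e0.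
have : geometric K th @ \oo --> (0 : R) by apply: cvg_geometric; rewrite ger0_norm.
move=> /cvgrPdist_le /(_ e e0) h.
near=> N; rewrite /series/= big_mkord; apply: le_trans (aS N) _.
have : `|0 - geometric K th N| <= e by near: N; exact: h.
by rewrite sub0r normrN; exact: le_trans (ler_norm _).
Unshelve. all: by end_near. Qed.

(** * Termwise differentiation of sums of poles *)

Section InversePowers.
Variable R : realType.
Implicit Types (a x y m : R) (p : nat).

Lemma Bernoulli_ineq x p : 0 <= x -> 1 + p%:R * (x - 1) <= x ^+ p.
Proof.
move=> x0; elim: p => [|p IH]; first by rewrite mul0r addr0 expr0.
rewrite exprS; apply: le_trans (ler_wpM2l x0 IH).
by rewrite -natr1; have := sqr_ge0 (x - 1); have : 0 <= p%:R :> R by []; nra.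
Qed.

(** The tangent inequality for the convex function x^-p, from Bernoulli's inequality for y/x and
    from y/x - 1 >= 1 - x/y. *)
Lemma invX_convex x y p : 0 < x -> 0 < y ->
  y ^- p - p%:R * (x - y) * y ^- p.+1 <= x ^- p.
Proof.
move=> x0 y0; have B := Bernoulli_ineq p (ltW (divr_gt0 y0 x0)).
rewrite -(ler_pM2l (exprn_gt0 p y0)).
have -> : y ^+ p * x ^- p = (y / x) ^+ p by rewrite expr_div_n.
apply: le_trans B.
have -> : y ^+ p * (y ^- p - p%:R * (x - y) * y ^- p.+1) =
    1 + p%:R * (1 - x / y).
  by rewrite exprS; field; rewrite expf_neq0 ?gt_eqF.
rewrite lerD2l ler_wpM2l//.
have := sqr_ge0 (x - y); rewrite -subr_ge0.
have -> : y / x - 1 - (1 - x / y) = (x - y) ^+ 2 / (x * y).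
  by field; rewrite !gt_eqF.
by move=> h; rewrite divr_ge0// ltW// mulr_gt0.
Qed.

(** The tangent inequalities at [y] and at [x] bound the remainder by p (x - y)(y^-(p+1) -
    x^-(p+1)); a third one, for the exponent p + 1, makes this quadratic in x - y. *)
Lemma invX_taylor2 x y m p : 0 < m -> m <= x -> m <= y ->
  `|x ^- p - y ^- p + p%:R * (x - y) * y ^- p.+1| <=
  p%:R * p.+1%:R * (x - y) ^+ 2 * m ^- p.+2.
Proof.
move=> m0 mx my; have x0 : 0 < x by exact: lt_le_trans mx.
have y0 : 0 < y by exact: lt_le_trans my.
have c1 := invX_convex p x0 y0; rewrite ger0_norm; last by lra.
have c2 := invX_convex p y0 x0.
have p0 : 0 <= p%:R :> R by [].
have mm z : m <= z -> z ^- p.+2 <= m ^- p.+2.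
  move=> mz; have z0 : 0 < z by exact: lt_le_trans mz.
  by rewrite lef_pV2 ?posrE ?exprn_gt0// lerXn2r// nnegrE ltW.
apply: (@le_trans _ _ (p%:R * ((x - y) * (y ^- p.+1 - x ^- p.+1)))); first by nra.
rewrite -!mulrA ler_wpM2l//.
have [xy|/ltW yx] := leP x y.
  have := invX_convex p.+1 y0 x0; have := mm _ mx.
  have : 0 <= p.+1%:R * (x - y) ^+ 2 :> R by rewrite mulr_ge0 ?sqr_ge0.
  set u := x ^- p.+2; set M := m ^- p.+2; set k := p.+1%:R.
  by move=> h1 h2 h3; nra.
have := invX_convex p.+1 x0 y0; have := mm _ my.
have : 0 <= p.+1%:R * (x - y) ^+ 2 :> R by rewrite mulr_ge0 ?sqr_ge0.
set u := y ^- p.+2; set M := m ^- p.+2; set k := p.+1%:R.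
by move=> h1 h2 h3; nra.
Qed.

End InversePowers.

Section TermwiseDerivative.
Variables (R : realType) (T : choiceType) (A : set T) (n : T -> R).
Hypothesis n1 : forall a, A a -> 1 <= n a.
Hypothesis nA : absum A (fun a => (n a)^-1).
Implicit Types (z h : R) (p : nat).

Definition polesum p z : R := sum_over A (fun a => (n a + z) ^- p).

(** The half-line z > -1/2 is an open neighbourhood of [0, 1] on which all the poles stay comparable
    to [n a], so that derivatives at the endpoints are covered. *)
Let half_le a z : A a -> - 2^-1 < z -> n a / 2 <= n a + z.
Proof. by move=> /n1 na z2; lra. Qed.

Let half_inv a p : A a -> (n a / 2) ^- p.+1 <= 2 ^+ p.+1 * (n a)^-1.
Proof.
move=> Aa; have na := n1 Aa; have n0 : 0 < n a by lra.
rewrite expr_div_n invfM invrK mulrC ler_wpM2l ?exprn_ge0//.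
by rewrite lef_pV2 ?posrE ?exprn_gt0// exprS ler_peMr ?(ltW n0)// exprn_ege1.
Qed.

Let inv_le a p z : A a -> - 2^-1 < z ->
  0 <= (n a + z) ^- p.+1 <= 2 ^+ p.+1 * (n a)^-1.
Proof.
move=> Aa z2; have na := n1 Aa; have m0 : 0 < n a / 2 by lra.
have nz := half_le Aa z2; have nz0 : 0 < n a + z by exact: lt_le_trans nz.
rewrite invr_ge0 exprn_ge0 ?(ltW nz0)//=; apply: le_trans (half_inv p Aa).
by rewrite lef_pV2 ?posrE ?exprn_gt0// lerXn2r// nnegrE ltW.
Qed.

Lemma absum_pole p z : - 2^-1 < z -> absum A (fun a => (n a + z) ^- p.+1).
Proof.
move=> z2; apply: (absum_le (g := fun a => 2 ^+ p.+1 * (n a)^-1)).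
  by move=> a Aa; have /andP[u0 u1] := inv_le p Aa z2; rewrite ger0_norm.
exact: absumZ.
Qed.

(** The second-order bound is summed over the family and gives an error of order h^2. The factor [k]
    lets the result be iterated directly for higher derivatives. *)
Lemma derive1_polesum k p z : - 2^-1 < z ->
  derive1 (fun y => k * polesum p.+1 y) z = k * - (p.+1%:R * polesum p.+2 z).
Proof.
move=> z2; set l := _ * - _; pose N := sum_over A (fun a => (n a)^-1).
have N0 : 0 <= N.
  by apply: sum_over_ge0 => a /n1 na; rewrite invr_ge0; lra.
pose C := p.+1%:R * p.+2%:R * 2 ^+ p.+3 * N.
have C0 : 0 <= C by rewrite /C mulr_ge0// mulr_ge0// exprn_ge0.
have key h : - 2^-1 < z + h ->
    `|polesum p.+1 (h + z) - polesum p.+1 z + p.+1%:R * h * polesum p.+2 z|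
    <= C * h ^+ 2.
  move=> zh; rewrite addrC in zh; rewrite /polesum.
  have a1 := absum_pole p zh; have a2 := absum_pole p z2.
  have a3 := absumZ (p.+1%:R * h) (absum_pole p.+1 z2).
  rewrite -sum_overZ; last exact: absum_pole.
  rewrite -sum_overB// -sum_overD//; last exact: absumB.
  apply: (@le_trans _ _ (sum_over A
      (fun a => p.+1%:R * p.+2%:R * 2 ^+ p.+3 * h ^+ 2 * (n a)^-1))).
    apply: ler_norm_sum_over; last exact: absumZ.
    move=> a Aa; have na := n1 Aa; have m0 : 0 < n a / 2 by lra.
    have t2 := invX_taylor2 p.+1 m0 (half_le Aa zh) (half_le Aa z2).
    have e : n a + (h + z) - (n a + z) = h by ring.
    rewrite e in t2; apply: le_trans t2 _.
    have := half_inv p.+2 Aa; have : 0 <= p.+1%:R * p.+2%:R * h ^+ 2 :> R.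
      by rewrite mulr_ge0 ?sqr_ge0.
    move=> k0 hi; apply: le_trans (ler_wpM2l k0 hi) _.
    by rewrite le_eqVlt; apply/orP; left; apply/eqP; ring.
  rewrite sum_overZ// /C -/N le_eqVlt; apply/orP; left; apply/eqP; ring.
rewrite /derive1; apply/cvg_lim => //; apply/cvgrPdist_le => e e0.
have kC : 0 < `|k| * C + 1 by rewrite ltr_wpDl// mulr_ge0.
have z2' : 0 < z + 2^-1 by lra.
near=> h.
have h0 : h != 0 by near: h; exact: nbhs_dnbhs_neq.
have hz : `|h| < z + 2^-1 by near: h; apply: dnbhs0_lt.
have he : `|h| <= e / (`|k| * C + 1).
  by near: h; apply: dnbhs0_le; rewrite divr_gt0.
have zh : - 2^-1 < z + h by move: hz; rewrite ltr_norml => /andP[? _]; lra.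
have -> : l - h^-1 *: (k * polesum p.+1 (h + z) - k * polesum p.+1 z) =
    - (k / h * (polesum p.+1 (h + z) - polesum p.+1 z +
                p.+1%:R * h * polesum p.+2 z)).
  by rewrite /l /GRing.scale/=; field.
rewrite normrN normrM normrM normfV.
apply: le_trans (ler_wpM2l _ (key h zh)) _; first by rewrite mulr_ge0 ?invr_ge0.
have -> : `|k| / `|h| * (C * h ^+ 2) = `|k| * C * `|h|.
  by rewrite -real_normK ?num_real//; field; rewrite normr_eq0.
apply: (@le_trans _ _ ((`|k| * C + 1) * `|h|)).
  by rewrite ler_wpM2r// lerDl.
by rewrite mulrC -ler_pdivlMr.
Unshelve. all: by end_near. Qed.

Lemma derive1n_polesum (f : R -> R) i z :
  (forall y, - 2^-1 < y -> f y = polesum 1 y) -> - 2^-1 < z ->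
  derive1n i f z = (-1) ^+ i * i`!%:R * polesum i.+1 z.
Proof.
move=> fE; elim: i z => [|i IH] z z2; first by rewrite derive1n0 fE// !mul1r.
rewrite derive1nS derive1E.
rewrite (@near_eq_derive _ _ _ _ (fun y => (-1) ^+ i * i`!%:R * polesum i.+1 y)).
  rewrite -derive1E derive1_polesum// exprS factS natrM; ring.
near=> y; apply: IH; near: y; exact: lt_nbhsr.
Unshelve. all: by end_near. Qed.

End TermwiseDerivative.

(** Both sides are the coefficient of h^i in (x + h - q)^k, once by Taylor's formula and once by the
    binomial theorem. *)
Lemma nderivn_XsubC_exp (R : realType) (q x : R) (k i : nat) :
  ((('X - q%:P) ^+ k)^`N(i)).[x] = 'C(k, i)%:R * (x - q) ^+ (k - i).
Proof.
set p := _ ^+ k; have sp : (size p <= k.+1)%N by rewrite size_exp_XsubC.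
have [ki|ik] := ltnP k i.
  by rewrite nderivn_poly0 ?(leq_trans sp)// horner0 bin_small// mul0r.
have e : \poly_(j < k.+1) p^`N(j).[x] =
    \poly_(j < k.+1) ((x - q) ^+ (k - j) *+ 'C(k, j)).
  apply: poly_ext => h; rewrite !horner_poly -nderiv_taylor_wide//; last exact: mulrC.
  rewrite horner_exp hornerXsubC addrAC exprDn.
  by apply: eq_bigr => j _; rewrite mulrnAl.
have := congr1 (fun r : {poly R} => r`_i) e.
by rewrite !coef_poly ltnS ik => ->; rewrite mulr_natl.
Qed.

(** * The modal expansion *)

Section Modal.
Variables (R : realType) (b : nat).
Hypothesis b1 : (1 < b)%N.
Variables (w v c : word b).
Hypotheses (fvw : fallback v w) (wvc : w = v ++ c).
Variable nu : nat -> probability (measurableTypeR R) R.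
Hypothesis hnu : forall j : nat, (1 <= j)%N -> stationary w j (nu j).
Variable B : nat -> {poly R}.
Hypothesis hB : forall m : nat, modal_poly w m (B m).
Let I01 : set (measurableTypeR R) := `[0%R, 1%R]%classic.
Let mI : measurable I01. Proof. exact: measurable_itv. Qed.

Let bR : 1 < b%:R :> R. Proof. by rewrite ltr1n. Qed.
Let b0 : 0 < b%:R :> R. Proof. exact: lt_trans ltr01 bR. Qed.

Let nu1 i : nu i.+1 I01 = 1%E. Proof. by case: (hnu (ltn0Sn i)). Qed.

Let lamE j : (1 <= j)%N ->
  (\esum_(g in langG w) (b%:R ^- (j * size g) : R)%:E)%E = (lambda R w j)%:E.
Proof. by move=> j1; exact/stationary_lambda/(hnu j1). Qed.

Let absum_G j : (1 <= j)%N ->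
  absum (langG w) (fun g => b%:R ^- (j * size g) : R).
Proof. exact: absum_langG lamE j. Qed.

Lemma size_period_gt0 : (0 < size c)%N.
Proof. by case: fvw => + _ _ _; rewrite wvc size_cat; lia. Qed.

Lemma langG_size g : langG w g -> (size c <= size g)%N.
Proof. by move=> /(langG_suffix fvw wvc)/size_suffix. Qed.

Lemma lambda_sum j : (1 <= j)%N ->
  lambda R w j = sum_over (langG w) (fun g => b%:R ^- (j * size g)).
Proof.
move=> j1; apply: EFin_inj; rewrite sum_overE ?lamE//.
exact: (absum_G j1).
Qed.

Lemma lambda_ge j : (1 <= j)%N -> b%:R ^- (j * size c) <= lambda R w j.
Proof.
move=> j1; rewrite lambda_sum//.
apply: (@sum_over_ge _ _ _ (fun g => b%:R ^- (j * size g))).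
- exact: langG_shortest wvc.
- by move=> g _; rewrite invr_ge0 exprn_ge0.
- exact: (absum_G j1).
Qed.

Lemma lambda_gt0 j : (1 <= j)%N -> 0 < lambda R w j.
Proof. by move/lambda_ge; apply: lt_le_trans; rewrite invr_gt0 exprn_gt0. Qed.

(** The words of [langG w] are non-empty, so raising the exponent by at least one multiplies each
    weight by at most b^-1. *)
Lemma lambda_lt i j : (1 <= i)%N -> (i < j)%N -> lambda R w j < lambda R w i.
Proof.
move=> i1 ij; have j1 : (1 <= j)%N by exact: leq_trans (ltnW ij).
apply: (@le_lt_trans _ _ (b%:R^-1 * lambda R w i)); last first.
  by rewrite gtr_pMl ?lambda_gt0// invf_lt1.
rewrite !lambda_sum// -sum_overZ; last exact: (absum_G i1).
apply: le_sum_over; [|exact: (absum_G j1)|exact/absumZ/(absum_G i1)].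
move=> g /langG_size cg; rewrite -invfM -exprS lef_pV2 ?posrE ?exprn_gt0//.
rewrite ler_eXn2l//; apply: (@leq_trans (i.+1 * size g)%N).
  by rewrite mulSn -add1n leq_add2r (leq_trans size_period_gt0).
by rewrite leq_mul2r ij orbT.
Qed.

(** * Duality between the measures and the modal polynomials *)

Definition dual_form i (p : {poly R}) : R := \int[nu i.+1]_(t in I01) (p^`N(i)).[t].

Lemma dual_formD i : {morph dual_form i : p r / p + r}.
Proof.
move=> p r; rewrite /dual_form nderivnD -RintegralD//; try exact: integrable_horner.
by apply: eq_Rintegral => t _; rewrite hornerD.
Qed.

Lemma dual_formZ i a (p : {poly R}) : dual_form i (a *: p) = a * dual_form i p.
Proof.
rewrite /dual_form nderivnZ -RintegralZl//; last exact: integrable_horner.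
by apply: eq_Rintegral => t _; rewrite hornerZ.
Qed.

Lemma dual_form_small i (p : {poly R}) : (size p <= i)%N -> dual_form i p = 0.
Proof.
move=> pi; rewrite /dual_form nderivn_poly0// -[RHS](Rintegral01_cst (nu1 i)).
by apply: eq_Rintegral => t _; rewrite horner0.
Qed.

Lemma dual_form_modal i m : dual_form i (B m) = (i == m)%:R.
Proof.
have [mB sB KB] := hB m; have [im|mi|->] := ltngtP i m.
- have [C _ rC] := poly_bound (B m)^`N(i) (ler01 : 0 <= 1 :> R).
  apply: (eigen_integral0 b1 (hnu (ltn0Sn i)) (C := C)
    (l := lambda R w m.+1)).
  + exact: measurable_poly.
  + move=> x; rewrite /I01/= in_itv/= => /andP[x0 x1]; apply: rC.
    by rewrite ger0_norm.
  + by move=> x _; apply: (Kop_nderivn b1 lamE KB).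
  + by rewrite lt_eqF// lambda_lt.
- by rewrite dual_form_small// sB.
- rewrite /dual_form -[RHS](Rintegral01_cst (nu1 m)); apply: eq_Rintegral => t _.
  suff -> : (B m)^`N(m) = 1 by rewrite hornerE.
  apply/polyP => k; rewrite coef_nderivn coef1; case: k => [|k].
    by move/monicP: mB; rewrite addn0 binn /lead_coef sB.
  by rewrite nth_default ?mul0rn// sB addnS ltnS leq_addr.
Qed.

Lemma modal_expansion n (p : {poly R}) : (size p <= n)%N ->
  p = \sum_(i < n) dual_form i p *: B i.
Proof.
elim: n p => [|n IH] p pn.
  by rewrite big_ord0; apply/eqP; rewrite -size_poly_eq0 -leqn0.
have [mB sB _] := hB n; pose p' := p - p`_n *: B n.
have p'n : (size p' <= n)%N.
  apply/leq_sizeP => k nk; rewrite coefB coefZ; move: nk; rewrite leq_eqVlt.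
  move=> /orP[/eqP<-|nk].
    by move/monicP: mB; rewrite /lead_coef sB /= => ->; rewrite mulr1 subrr.
  have pk := leq_trans pn nk; have Bk : (size (B n) <= k)%N by rewrite sB.
  by rewrite (nth_default _ pk) (nth_default _ Bk) mulr0 subr0.
have pE : p = p' + p`_n *: B n by rewrite subrK.
have formp i : dual_form i p = dual_form i p' + p`_n * (i == n)%:R.
  by rewrite {1}pE dual_formD dual_formZ dual_form_modal.
rewrite big_ord_recr/= {1}pE; congr (_ + _).
  rewrite {1}(IH _ p'n); apply: eq_bigr => i _.
  by rewrite formp ltn_eqF ?ltn_ord// mulr0 addr0.
by rewrite formp dual_form_small// eqxx mulr1 add0r.
Qed.

(** * Concentration of the measures at the fixed point *)

Let P : R := b%:R ^+ size c.

(** The value of the periodic expansion 0.ccc... in base b. *)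
Definition centre : R := (nval c)%:R / (P - 1).
Local Notation q := centre.

Let P2 : 2 <= P.
Proof.
apply: (@le_trans _ _ (b%:R : R)); first by rewrite (ler_nat _ 2 b).
by rewrite -[leLHS]expr1 ler_eXn2l// size_period_gt0.
Qed.

Let P0 : 0 < P. Proof. exact: lt_le_trans P2. Qed.
Let PB0 : 0 < P - 1. Proof. by have := P2; lra. Qed.

Lemma centre_itv : 0 <= q <= 1.
Proof.
apply/andP; split; first by rewrite divr_ge0// ltW.
by rewrite ler_pdivrMr// mul1r lerBrDr natr1 /P -natrX ler_nat nval_lt.
Qed.

Lemma centre_fixed : (nval c)%:R = q * (P - 1).
Proof. by rewrite /centre mulfVK// gt_eqF. Qed.

Definition moment i n : R := \int[nu i.+1]_(t in I01) `|t - q| ^+ n.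

Let I01E t : I01 t -> 0 <= t <= 1. Proof. by rewrite /I01/= in_itv. Qed.

Lemma dist_centre t : 0 <= t <= 1 -> `|t - q| <= 1.
Proof. by move=> /andP[? ?]; have /andP[? ?] := centre_itv; rewrite ler_norml; lra. Qed.

Let measurable_dist (D : set (measurableTypeR R)) n (g : word b) :
  measurable_fun D (fun t : measurableTypeR R => `|phi g t - q| ^+ n).
Proof.
apply: measurable_funX; apply: measurableT_comp => //.
by apply: measurable_funB => //; exact: measurable_funTS (@measurable_phi R b g).
Qed.

Let measurable_dist0 (D : set (measurableTypeR R)) n :
  measurable_fun D (fun t : measurableTypeR R => `|t - q| ^+ n).
Proof. by apply: measurable_funX; apply: measurableT_comp => //; exact: measurable_funB. Qed.

Let expr_norm_le1 (x : R) n : `|x| <= 1 -> `| `|x| ^+ n | <= 1.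
Proof. by move=> x1; rewrite normrX normr_id exprn_ile1. Qed.

Let integrable_dist i n (g : word b) :
  (nu i.+1).-integrable I01 (EFin \o fun t => `|phi g t - q| ^+ n).
Proof.
apply: (@bounded_integrable01 _ _ _ 1); first exact: measurable_dist.
move=> t /I01E t01; apply: expr_norm_le1; apply: dist_centre.
exact: phi_itv.
Qed.

Let integrable_dist0 i n :
  (nu i.+1).-integrable I01 (EFin \o fun t => `|t - q| ^+ n).
Proof.
apply: (@bounded_integrable01 _ _ _ 1); first exact: measurable_dist0.
by move=> t /I01E t01; apply: expr_norm_le1; exact: dist_centre.
Qed.

Lemma moment_ge0 i n : 0 <= moment i n.
Proof. by apply: Rintegral_ge0 => t _; rewrite exprn_ge0. Qed.

(* For [g = x ++ c] in [G] with [x] non-empty, [beta g = b^-|x|], and [phi g]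
   maps [0, 1] into the ball of centre [q] and radius [tau g]. *)
Definition langG' : set (word b) := langG w `\` [set c].
Definition beta (g : word b) : R := P / b%:R ^+ size g.
Definition tau (g : word b) : R := 1 - beta g + beta g / P.

Lemma langG'_split g : langG' g -> exists2 x, g = x ++ c & x <> [::].
Proof.
move=> [Gg gc]; have /suffixP[x gx] := langG_suffix fvw wvc Gg.
by exists x => // x0; apply: gc; rewrite gx x0.
Qed.

Lemma beta_gt0 g : 0 < beta g. Proof. by rewrite divr_gt0// exprn_gt0. Qed.

Lemma beta_cat x : beta (x ++ c) = b%:R ^- size x.
Proof. by rewrite /beta size_cat exprD invfM mulrCA mulfV ?mulr1// gt_eqF. Qed.

Lemma beta_le g : langG' g -> beta g <= b%:R^-1.
Proof.
move=> /langG'_split[x -> x0]; rewrite beta_cat lef_pV2 ?posrE ?exprn_gt0//.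
by rewrite -[leLHS]expr1 ler_eXn2l//; case: x x0.
Qed.

Lemma tau_itv g : langG' g -> 0 <= tau g <= 1.
Proof.
move=> Gg; have := beta_le Gg; have := beta_gt0 g.
have : b%:R^-1 <= 1 :> R by rewrite invf_le1// ltW.
have Pi : 0 < P^-1 by rewrite invr_gt0.
have Pi1 : P^-1 <= 1 by rewrite invf_le1//; have := P2; lra.
by rewrite /tau; nra.
Qed.

(** For g = x ++ c and be = b^-|x|, [phi g t - q] is n(x) be - (1 - be) q plus (be / P)(t - q). The
    first part is a difference of two numbers of [0, 1 - be], and the second is at most be / P in
    absolute value. *)
Lemma phi_centre_dist g t : langG' g -> 0 <= t <= 1 -> `|phi g t - q| <= tau g.
Proof.
move=> /langG'_split[x -> _] t01; rewrite phiE /tau beta_cat.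
have tq := dist_centre t01; have /andP[q0 q1] := centre_itv.
set be : R := b%:R ^- size x; have be0 : 0 < be by rewrite invr_gt0 exprn_gt0.
have -> : (nval (x ++ c))%:R = (nval x)%:R * P + q * (P - 1).
  by rewrite -centre_fixed nval_cat natrD natrM natrX.
have -> : b%:R ^+ size (x ++ c) = P / be :> R.
  by rewrite size_cat exprD /be invrK mulrC.
have X : (nval x)%:R * be <= 1 - be.
  rewrite lerBrDr -[X in _ + X]mul1r -mulrDl natr1 ler_pdivrMr ?exprn_gt0// mul1r.
  by rewrite -natrX ler_nat nval_lt.
have X0 : 0 <= (nval x)%:R * be by rewrite mulr_ge0// ltW.
have -> : ((nval x)%:R * P + q * (P - 1) + t) / (P / be) - q =
    ((nval x)%:R * be - (1 - be) * q) + be / P * (t - q).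
  by field; rewrite !gt_eqF.
apply: le_trans (ler_normD _ _) _; apply: lerD.
  by rewrite ler_norml; nra.
have bP : 0 <= be / P by rewrite ltW// divr_gt0.
by rewrite normrM (ger0_norm bP) ler_piMr.
Qed.

Let absum_langG' j (f : word b -> R) : (1 <= j)%N ->
  (forall g, langG' g -> 0 <= f g <= beta g ^+ j) -> absum langG' f.
Proof.
move=> j1 fb; apply: (absum_le (g := fun g => P ^+ j * b%:R ^- (j * size g))).
  move=> g /fb/andP[f0 f1]; rewrite ger0_norm// (le_trans f1)// /beta.
  by rewrite exprMn exprVn mulnC exprM lexx.
apply: absumZ; apply: le_lt_trans (absum_G j1).
by apply: le_esum_subset => [g []//|g _]; rewrite lee_fin.
Qed.

Let absum_beta_tau j n : (1 <= j)%N ->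
  absum langG' (fun g => beta g ^+ j * tau g ^+ n).
Proof.
move=> j1; apply: absum_langG' (j1) _ => g /tau_itv/andP[t0 t1].
have be0 := ltW (beta_gt0 g).
by rewrite mulr_ge0 ?exprn_ge0//= ler_piMr ?exprn_ge0// exprn_ile1.
Qed.

(* In the stationarity of [nu i.+1], the word [c] contributes exactly [P^-n]
   times the moment itself, which the left-hand side absorbs. *)
Lemma moment_le i n : (0 < n)%N ->
  moment i n <= 2 * sum_over langG' (fun g => beta g ^+ i.+1 * tau g ^+ n).
Proof.
move=> n0; pose f (t : measurableTypeR R) : \bar R := (`|t - q| ^+ n)%:E.
have mf : measurable_fun I01 f by apply/measurable_EFinP; exact: measurable_dist0.
have f0 t : I01 t -> (0 <= f t)%E by rewrite lee_fin exprn_ge0.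
pose k : R := P ^- i.+1; have k0 : 0 < k by rewrite invr_gt0 exprn_gt0.
set S := sum_over _ _.
have kE g : b%:R ^- (i.+1 * size g) = k * beta g ^+ i.+1 :> R.
  by rewrite /k /beta exprMn exprVn mulKf ?expf_neq0 ?gt_eqF// mulnC exprM.
have le1 : lambda R w i.+1 * moment i n <= k * (P ^- n * moment i n) + k * S.
  rewrite -lee_fin EFinM EFin_Rintegral; last exact: integrable_dist0.
  rewrite (stationary_integral b1 (hnu (ltn0Sn i)) mf f0).
  have Gc : langG w c by exact: langG_shortest wvc.
  rewrite (esumID [set c]); last first.
    move=> g _; apply: mule_ge0; first by rewrite lee_fin invr_ge0 exprn_ge0.
    by apply: integral_ge0 => t It; exact/f0/I01E/phi_itv.
  rewrite setIidr => [|_ ->//]; rewrite EFinD; apply: leeD.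
    rewrite esum_set1; last first.
      apply: mule_ge0; first by rewrite lee_fin invr_ge0 exprn_ge0.
      by apply: integral_ge0 => t It; rewrite lee_fin exprn_ge0.
    rewrite kE /beta divff ?gt_eqF ?exprn_gt0// expr1n mulr1 EFinM.
    rewrite lee_wpmul2l ?lee_fin ?(ltW k0)// -EFin_Rintegral; last first.
      exact: integrable_dist.
    rewrite lee_fin /moment -RintegralZl//; last exact: integrable_dist0.
    rewrite le_eqVlt; apply/orP; left; apply/eqP/eq_Rintegral => t _.
    rewrite -exprVn -exprMn; congr (_ ^+ _).
    rewrite -[P^-1]ger0_norm ?invr_ge0 ?ltW// -normrM; congr `|_|.
    by rewrite phiE centre_fixed -/P; field; rewrite gt_eqF.
  rewrite EFinM /S sum_overE; last first.
  - exact: absum_beta_tau.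
  - move=> g /tau_itv/andP[t0 _].
    by rewrite mulr_ge0 ?exprn_ge0// ltW// beta_gt0.
  rewrite -esumZl ?(ltW k0)//; last first.
    move=> g /tau_itv/andP[t0 _].
    by rewrite lee_fin mulr_ge0 ?exprn_ge0// ltW// beta_gt0.
  apply: le_esum => g Gg; rewrite kE EFinM -muleA lee_wpmul2l ?lee_fin ?(ltW k0)//.
  rewrite EFinM lee_wpmul2l ?lee_fin ?exprn_ge0 ?(ltW (beta_gt0 _))//.
  rewrite -EFin_Rintegral; last exact: integrable_dist.
  rewrite lee_fin; apply: le_trans (ler_norm _) _.
  apply: (Rintegral01_bound (nu1 i)); first exact: measurable_dist.
  move=> t /I01E t01; rewrite normrX normr_id lerXn2r ?nnegrE//.
    by have /andP[] := tau_itv Gg.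
  exact: phi_centre_dist.
have lam : k <= lambda R w i.+1.
  by have := @lambda_ge i.+1 isT; rewrite kE /beta divff ?expr1n ?mulr1// gt_eqF ?exprn_gt0.
(* Since n > 0, at most half of the moment is absorbed, whence the factor 2 of the statement. *)
have Pn : P ^- n <= 2^-1.
  rewrite lef_pV2 ?posrE ?exprn_gt0//; apply: (le_trans P2).
  by rewrite -[leLHS]expr1 ler_eXn2l//; have := P2; lra.
have m0 := moment_ge0 i n.
rewrite -(ler_pM2l k0).
have : k * moment i n <= k * (P ^- n * moment i n) + k * S.
  by apply: le_trans le1; rewrite ler_wpM2r.
have : P ^- n * moment i n <= 2^-1 * moment i n by rewrite ler_wpM2r.
nra.
Qed.

(* By the binomial theorem, the bounds of [moment_le] sum up to powers of
   [tau g + beta g * r = 1 + beta g * (r - 1 + P^-1)], and [beta g <= b^-1]. *)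
Definition rate (r : R) : R := 1 + (r - 1 + P^-1) / b%:R.

(** The 2 comes from [moment_le], and [P * lambda R w 1] is the sum of [beta] over [langG w]. *)
Definition gap : R := 2 * P * lambda R w 1.

Lemma moment_sum_le (r : R) m : 1 <= r ->
  \sum_(i < m) 'C(m, i)%:R * moment i (m - i) * r ^+ i <= gap * rate r ^+ m.
Proof.
move=> r1; have r0 : 0 <= r by lra.
have Pi : 0 < P^-1 by rewrite invr_gt0.
pose F (i : nat) g := 'C(m, i)%:R * r ^+ i * (beta g ^+ i.+1 * tau g ^+ (m - i)).
apply: (@le_trans _ _ (2 * \sum_(i < m) sum_over langG' (F i))).
  rewrite mulr_sumr; apply: ler_sum => i _.
  rewrite /F sum_overZ; last exact: absum_beta_tau.
  rewrite mulrCA mulrAC; apply: ler_wpM2l; first by rewrite mulr_ge0 ?exprn_ge0.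
  by apply: moment_le; rewrite subn_gt0.
rewrite -(@sum_over_sum _ _ langG' _ _ (fun i : 'I_m => F i)); last first.
  by move=> i; exact/absumZ/absum_beta_tau.
have rate0 : 0 <= rate r by rewrite addr_ge0// divr_ge0 ?ltW//; lra.
rewrite /gap -!mulrA ler_pM2l//.
have aG := absum_G (ltn0Sn 0).
have aG' : absum langG' (fun g => P * rate r ^+ m * b%:R ^- (1 * size g)).
  apply: le_lt_trans (absumZ (P * rate r ^+ m) aG).
  by apply: le_esum_subset => [g []//|g _]; rewrite lee_fin.
apply: (@le_trans _ _ (sum_over langG'
    (fun g => P * rate r ^+ m * b%:R ^- (1 * size g)))).
  apply: le_sum_over => //; last first.
    by apply: absum_sum => i; exact/absumZ/absum_beta_tau.
  move=> g Gg; have be0 := ltW (beta_gt0 g); have beb := beta_le Gg.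
  have /andP[t0 _] := tau_itv Gg.
  have -> : P * rate r ^+ m * b%:R ^- (1 * size g) = beta g * rate r ^+ m.
    by rewrite /beta mul1n; ring.
  apply: (@le_trans _ _ (beta g * (tau g + beta g * r) ^+ m)).
    rewrite exprDn big_ord_recr/= mulrDr -[leLHS]addr0; apply: lerD.
      rewrite le_eqVlt mulr_sumr; apply/orP; left; apply/eqP/eq_bigr => i _.
      by rewrite /F [(beta g * r) ^+ i]exprMn [beta g ^+ i.+1]exprS -[in RHS]mulr_natr; ring.
    by rewrite mulr_ge0// mulrn_wge0// mulr_ge0 ?exprn_ge0// mulr_ge0.
  apply: ler_wpM2l => //; apply: lerXn2r; rewrite ?nnegrE//.
    by rewrite addr_ge0// mulr_ge0.
  have h : 0 <= r - 1 + P^-1 by lra.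
  have -> : tau g + beta g * r = 1 + beta g * (r - 1 + P^-1) by rewrite /tau; ring.
  by rewrite /rate lerD2l [leRHS]mulrC ler_wpM2r.
rewrite lambda_sum// mulrA mulrAC -sum_overZ//.
have aGG := absumZ (P * rate r ^+ m) aG.
have w0 g : 0 <= P * rate r ^+ m * b%:R ^- (1 * size g).
  by rewrite mulr_ge0 ?invr_ge0 ?exprn_ge0// mulr_ge0 ?exprn_ge0// ltW.
rewrite -lee_fin !sum_overE//; apply: le_esum_subset => [g []//|g _].
by rewrite lee_fin.
Qed.

(** The claim amounts to 1/P < (b - 1)(r - 1). The threshold 1 + 1/P is exact for b = 2, the least
    favourable base. *)
Lemma rate_lt (r : R) : 1 + P^-1 < r -> rate r < r.
Proof.
move=> rP; have := P2; have Pi : 0 < P^-1 by rewrite invr_gt0.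
rewrite /rate -ltrBrDl ltr_pdivrMr// => _.
have b2 : 2 <= b%:R :> R by rewrite (ler_nat _ 2 b).
nra.
Qed.

(* The coefficient of [B i] in the expansion of [(X - q)^k]. *)
Definition modal_coef k i : R := dual_form i (('X - q%:P) ^+ k).

Lemma modal_coef_le k i : `|modal_coef k i| <= 'C(k, i)%:R * moment i (k - i).
Proof.
have mq n : measurable_fun I01 (fun t : measurableTypeR R => (t - q) ^+ n).
  by apply: measurable_funX; exact: measurable_funB.
have iq n : (nu i.+1).-integrable I01 (EFin \o fun t : R => (t - q) ^+ n).
  apply: (@bounded_integrable01 _ _ _ 1) => // t /I01E t01.
  by rewrite normrX exprn_ile1// dist_centre.
have -> : modal_coef k i = 'C(k, i)%:R * \int[nu i.+1]_(t in I01) (t - q) ^+ (k - i).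
  rewrite /modal_coef /dual_form -RintegralZl//; apply: eq_Rintegral => t _.
  exact: nderivn_XsubC_exp.
rewrite normrM normr_nat ler_wpM2l//.
apply: le_trans (le_normr_Rintegral _ _) _ => //.
rewrite le_eqVlt; apply/orP; left; apply/eqP; rewrite /moment.
by apply: eq_Rintegral => t _; rewrite normrX.
Qed.

Lemma modal_coef_diag k : modal_coef k k = 1.
Proof.
rewrite /modal_coef /dual_form -[RHS](Rintegral01_cst (nu1 k)); apply: eq_Rintegral => t _.
by rewrite nderivn_XsubC_exp binn subnn expr0 mulr1.
Qed.

Lemma modal_coef_sum_le (r : R) m : 1 <= r ->
  \sum_(i < m) `|modal_coef m i| * r ^+ i <= gap * rate r ^+ m.
Proof.
move=> r1; apply: le_trans (moment_sum_le m r1); apply: ler_sum => i _.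
by rewrite ler_wpM2r ?modal_coef_le// exprn_ge0//; lra.
Qed.

Lemma XsubC_expansion m x :
  (B m).[x] = (x - q) ^+ m - \sum_(i < m) modal_coef m i * (B i).[x].
Proof.
have := @modal_expansion m.+1 (('X - q%:P) ^+ m).
rewrite size_exp_XsubC => /(_ (leqnn _)) /(congr1 (fun p : {poly R} => p.[x])).
rewrite horner_exp hornerXsubC horner_sum big_ord_recr/= hornerZ.
rewrite -/(modal_coef m m) modal_coef_diag mul1r => ->.
rewrite addrAC [X in _ = X + _](_ : _ = 0) ?add0r//; apply/eqP; rewrite subr_eq0.
by apply/eqP/eq_bigr => i _; rewrite hornerZ.
Qed.

(** * Growth of the modal polynomials *)

Lemma gap_ge0 : 0 <= gap.
Proof. by rewrite !mulr_ge0// ltW// lambda_gt0. Qed.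

(** By the recursion [XsubC_expansion], a common bound on |B i (x)| / r^i for i <= m is multiplied
    by at most 1 + gap th^(m+1) when m increases, with th = rate r / r < 1. The exponential [E]
    majorises the product of these factors and stays bounded. *)
Lemma modal_poly_le (r : R) : 1 + P^-1 < r -> exists2 C : R, 0 < C &
  forall m x, `|x - q| <= r -> `|(B m).[x]| <= C * r ^+ m.
Proof.
move=> rP; have Pi : 0 < P^-1 by rewrite invr_gt0.
have r1 : 1 < r by lra. have r0 : 0 < r by lra.
have rate0 : 0 <= rate r by rewrite addr_ge0// divr_ge0 ?ltW//; lra.
pose th := rate r / r.
have th0 : 0 <= th by rewrite divr_ge0// ltW.
have th1 : th < 1 by rewrite ltr_pdivrMr// mul1r rate_lt.
pose E m : R := expR (\sum_(k < m.+1) gap * th ^+ k).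
have E1 m : 1 <= E m.
  by rewrite -expR0 ler_expR sumr_ge0// => i _; rewrite mulr_ge0 ?gap_ge0 ?exprn_ge0.
have key m x : `|x - q| <= r -> forall i, (i <= m)%N -> `|(B i).[x]| <= E m * r ^+ i.
  move=> xr; elim: m => [|m IH] i.
    rewrite leqn0 => /eqP->; rewrite XsubC_expansion big_ord0 subr0 !expr0 mulr1.
    by rewrite normr1.
  have EE : E m * (1 + gap * th ^+ m.+1) <= E m.+1.
    have -> : E m.+1 = E m * expR (gap * th ^+ m.+1).
      by rewrite {1}/E big_ord_recr/= expRD.
    by rewrite ler_wpM2l ?expR_ge0// expR_ge1Dx.
  have Em : E m <= E m.+1.
    apply: le_trans EE; rewrite ler_peMr ?(le_trans ler01)// lerDl.
    by rewrite mulr_ge0 ?gap_ge0 ?exprn_ge0.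
  rewrite leq_eqVlt => /orP[/eqP->|im]; last first.
    by apply: le_trans (IH i im) _; rewrite ler_wpM2r// exprn_ge0// ltW.
  rewrite XsubC_expansion; apply: le_trans (ler_normB _ _) _.
  apply: (@le_trans _ _ (r ^+ m.+1 + E m * (gap * rate r ^+ m.+1))).
    apply: lerD; first by rewrite normrX lerXn2r// nnegrE// ltW.
    apply: le_trans (ler_norm_sum _ _ _) _.
    apply: le_trans (ler_wpM2l (le_trans ler01 (E1 m)) (modal_coef_sum_le m.+1 (ltW r1))).
    rewrite mulr_sumr; apply: ler_sum => j _.
    rewrite normrM mulrCA; apply: ler_wpM2l => //.
    by apply: IH; rewrite -ltnS.
  apply: le_trans (ler_wpM2r (exprn_ge0 m.+1 (ltW r0)) EE).
  have -> : rate r ^+ m.+1 = th ^+ m.+1 * r ^+ m.+1.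
    by rewrite -exprMn divfK// gt_eqF.
  rewrite mulrDr mulr1 mulrDl [gap * _]mulrA mulrA lerD2r.
  by apply: ler_peMl => //; rewrite exprn_ge0// ltW.
exists (expR (gap / (1 - th))); first exact: expR_gt0.
move=> m x xr; apply: le_trans (key m x xr m (leqnn m)) _.
rewrite ler_wpM2r ?exprn_ge0 ?(ltW r0)// ler_expR -mulr_sumr.
rewrite ler_wpM2l ?gap_ge0//.
rewrite -[leRHS]mul1r ler_pdivlMr ?subr_gt0// mulrC.
have -> : (1 - th) * (\sum_(k < m.+1) th ^+ k) = 1 - th ^+ m.+1.
  by rewrite -[1 - th]opprB mulNr -subrX1 opprB.
by rewrite gerBl exprn_ge0.
Qed.

(** * Modal expansion of one pole *)

(** Up to the sign (-1)^i, the functional [dual_form i] evaluated at the function t |-> 1/(s + t),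
    which is not a polynomial. *)
Definition polemom i (s : R) : R := \int[nu i.+1]_(t in I01) (s + t) ^- i.+1.

Let measurable_pole n (s : R) : 0 < s ->
  measurable_fun I01 (fun t : measurableTypeR R => (s + t) ^- n).
Proof.
move=> s0; under eq_fun do rewrite -exprVn.
apply: measurable_funX; apply: subspace_continuous_measurable_fun => //.
apply: continuous_in_subspaceT => t /set_mem/I01E/andP[t0 _].
apply: cvgV; first by rewrite gt_eqF// ltr_wpDr.
by apply: cvgD; [exact: cvg_cst|exact: cvg_id].
Qed.

Let integrable_pole i n (s : R) : 0 < s ->
  (nu i.+1).-integrable I01 (EFin \o fun t : R => (s + t) ^- n).
Proof.
move=> s0; apply: (@bounded_integrable01 _ _ _ (s ^- n)).
  exact: measurable_pole.
move=> t /I01E/andP[t0 _].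
have st : 0 < s + t by rewrite ltr_wpDr.
rewrite ger0_norm ?invr_ge0 ?exprn_ge0 ?(ltW st)//.
by rewrite lef_pV2 ?posrE ?exprn_gt0// lerXn2r ?nnegrE ?(ltW st) ?(ltW s0)// lerDl.
Qed.

Lemma polemom_ge0 i s : 0 <= s -> 0 <= polemom i s.
Proof.
move=> s0; apply: Rintegral_ge0 => t /I01E/andP[t0 _].
by rewrite invr_ge0 exprn_ge0// addr_ge0.
Qed.

Let measurable_sub n (D : set (measurableTypeR R)) :
  measurable_fun D (fun t : measurableTypeR R => (t - q) ^+ n).
Proof. by apply: measurable_funX; exact: measurable_funB. Qed.

Let integrable_sub i n :
  (nu i.+1).-integrable I01 (EFin \o fun t : R => (t - q) ^+ n).
Proof.
apply: (@bounded_integrable01 _ _ _ 1) => // t /I01E t01.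
by rewrite normrX exprn_ile1// dist_centre.
Qed.

Lemma modal_coefE k i :
  modal_coef k i = 'C(k, i)%:R * \int[nu i.+1]_(t in I01) (t - q) ^+ (k - i).
Proof.
rewrite /modal_coef /dual_form -RintegralZl//; last exact: integrable_sub.
by apply: eq_Rintegral => t _; exact: nderivn_XsubC_exp.
Qed.

Lemma polemom_cvg i s : 0 < s -> 1 < s + q ->
  (fun N => \sum_(k < N) (-1) ^+ k * (s + q) ^- k.+1 * modal_coef k i) @ \oo -->
  (-1) ^+ i * polemom i s.
Proof.
move=> s0 S1; set S := s + q; have S0 : 0 < S by rewrite (lt_trans ltr01).
have y01 : 0 <= S^-1 < 1 by rewrite invr_ge0 (ltW S0)/= invf_lt1.
have [e ecvg eP] := negbin_sum_cvg i y01.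
pose x t : R := - (t - q) / S.
have xS t : I01 t -> `|x t| <= S^-1.
  move=> /I01E t01; rewrite normrM normrN normfV (gtr0_norm S0).
  by rewrite ler_piMl ?invr_ge0 ?(ltW S0)// dist_centre.
have term t k : (-1) ^+ k * S ^- k.+1 * ('C(k, i)%:R * (t - q) ^+ (k - i)) =
    (-1) ^+ i * S ^- i.+1 * ('C(k, i)%:R * x t ^+ (k - i)).
  have [ki|ik] := ltnP k i; first by rewrite bin_small// !mul0r !mulr0.
  set m := (k - i)%N; have km : k = (m + i)%N by rewrite subnK.
  have -> : (-1) ^+ k = (-1) ^+ m * (-1) ^+ i :> R by rewrite km exprD.
  have -> : S ^- k.+1 = S ^- m * S ^- i.+1 by rewrite km -addnS exprD invfM.
  have -> : x t ^+ m = (-1) ^+ m * (t - q) ^+ m * S ^- m.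
    by rewrite /x [LHS]exprMn (exprNn (t - q)) exprVn.
  by ring.
pose F N t : R := \sum_(k < N) (-1) ^+ k * S ^- k.+1 *
  ('C(k, i)%:R * (t - q) ^+ (k - i)).
have FE N t : F N t = (-1) ^+ i * S ^- i.+1 * negbin_sum i N (x t).
  by rewrite /F /negbin_sum mulr_sumr; apply: eq_bigr => k _; exact: term.
have iF N : (nu i.+1).-integrable I01 (EFin \o F N).
  have -> : EFin \o F N = (fun t => \sum_(k < N) (((-1) ^+ k * S ^- k.+1 *
      'C(k, i)%:R)%:E * ((t - q) ^+ (k - i))%:E))%E.
    apply/funext => t /=; rewrite /F -sumEFin.
    by apply: eq_bigr => k _; rewrite mulrA EFinM.
  apply: integrable_sum => // k _; apply: integrableZl => //.
  exact: integrable_sub.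
have sumE N : \sum_(k < N) (-1) ^+ k * S ^- k.+1 * modal_coef k i =
    \int[nu i.+1]_(t in I01) F N t.
  elim: N iF => [|N IH] iF.
    rewrite big_ord0 -[LHS](Rintegral01_cst (nu1 i)).
    by apply: eq_Rintegral => t _; rewrite /F big_ord0.
  rewrite big_ord_recr/= IH// modal_coefE mulrA -RintegralZl//; last exact: integrable_sub.
  rewrite -RintegralD//.
    by apply: eq_Rintegral => t _; rewrite /F big_ord_recr/= mulrA.
  exact: (integrableZl mI _ (integrable_sub i (N - i))).
under eq_fun do rewrite sumE.
pose c0 : R := (-1) ^+ i.
have polE : c0 * polemom i s = \int[nu i.+1]_(t in I01) (c0 * (s + t) ^- i.+1).
  by rewrite RintegralZl//; exact: integrable_pole.
rewrite polE; apply/cvgrPdist_le => d d0.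
near=> N; have eN : `|e N| <= d by near: N; exact: cvgr0_norm_le.
have ip := integrableZl mI c0 (integrable_pole i i.+1 s0).
rewrite -RintegralB//; apply: (Rintegral01_bound (nu1 i)).
  apply: measurable_funB.
    by apply: measurable_funM => //; exact: measurable_pole.
  by apply/measurable_EFinP; case/integrableP: (iF N).
move=> t It; rewrite FE.
have st : (s + t) ^- i.+1 = S ^- i.+1 * (1 - x t) ^- i.+1.
  rewrite -invfM -exprMn; congr (_ ^- _); rewrite /x /S; field.
  by rewrite gt_eqF.
rewrite st mulrA -mulrBr normrM.
have cS : `|c0 * S ^- i.+1| <= 1.
  rewrite normrM /c0 normrX normrN1 expr1n mul1r ger0_norm.
    by rewrite invf_le1 ?exprn_gt0// exprn_ege1// ltW.
  by rewrite invr_ge0 exprn_ge0// ltW.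
apply: le_trans (ler_piMl _ cS) _ => //.
by apply: le_trans (eP N _ (xS t It)) _; exact: le_trans (ler_norm _) eN.
Unshelve. all: by end_near. Qed.

(** Truncation to J modes is exact on (z - q)^k for k < J, so only the powers k >= J contribute to
    the error. In their bound r^k / (s + q)^(k+1), one factor 1/(s + q) is kept and the others are
    replaced by powers of 1/sg. *)
Lemma pole_expansion (r sg : R) : 1 + P^-1 < r -> r < sg ->
  exists2 K : R, 0 <= K & forall s z J, 0 < s -> sg <= s + q -> `|z - q| <= r ->
    `|(s + z)^-1 - \sum_(i < J) (-1) ^+ i * polemom i s * (B i).[z]| <=
    K * (r / sg) ^+ J / (s + q).
Proof.
move=> rP rsg; have [C C0 BC] := modal_poly_le rP.
have Pi : 0 < P^-1 by rewrite invr_gt0.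
have r1 : 1 < r by lra. have r0 : 0 < r by lra. have sg0 : 0 < sg by lra.
pose th := r / sg; have th0 : 0 <= th by rewrite divr_ge0 ?ltW.
have th1 : th < 1 by rewrite ltr_pdivrMr// mul1r.
have rate0 : 0 <= rate r by rewrite addr_ge0// divr_ge0 ?ltW//; lra.
(* [C * gap] accounts for the truncated modal expansion of a power, and 1 for the power itself. *)
pose D := C * gap + 1.
have D0 : 0 <= D by rewrite addr_ge0// mulr_ge0 ?gap_ge0// ltW.
exists (D / (1 - th)); first by rewrite divr_ge0// subr_ge0 ltW.
move=> s z J s0 sS zr; set S := s + q; have S0 : 0 < S by rewrite (lt_le_trans sg0).
have S1 : 1 < S by rewrite (lt_le_trans _ sS)//; lra.
pose u k : R := (-1) ^+ k * S ^- k.+1.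
have uE k : `|u k| = S ^- k.+1.
  by rewrite normrM normrX normrN1 expr1n mul1r ger0_norm// invr_ge0 exprn_ge0// ltW.
(* The projection of (z - q)^k onto the first J modes. *)
pose T k := \sum_(i < J) modal_coef k i * (B i).[z].
have Tlt k : (k < J)%N -> T k = (z - q) ^+ k.
  move=> kJ; have := @modal_expansion J (('X - q%:P) ^+ k).
  rewrite size_exp_XsubC => /(_ kJ) /(congr1 (fun p : {poly R} => p.[z])).
  rewrite horner_exp hornerXsubC horner_sum => ->.
  by apply: eq_bigr => i _; rewrite hornerZ.
have Tge k : (J <= k)%N -> `|T k - (z - q) ^+ k| <= D * r ^+ k.
  move=> Jk; apply: le_trans (ler_normB _ _) _; rewrite /D mulrDl mul1r.
  apply: lerD; last by rewrite normrX lerXn2r// nnegrE// ltW.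
  apply: le_trans (ler_norm_sum _ _ _) _.
  apply: (@le_trans _ _ (\sum_(i < k) C * (`|modal_coef k i| * r ^+ i))).
    rewrite (big_ord_widen k (fun i => `|modal_coef k i * (B i).[z]|))//.
    rewrite big_mkcond; apply: ler_sum => i _.
    case: ifP => _; last by rewrite !mulr_ge0 ?exprn_ge0// ltW.
    by rewrite normrM mulrCA ler_wpM2l// BC.
  rewrite -mulr_sumr -mulrA ler_wpM2l ?(ltW C0)//.
  apply: le_trans (modal_coef_sum_le k (ltW r1)) _.
  by rewrite ler_wpM2l ?gap_ge0// lerXn2r ?nnegrE ?(ltW r0)// ltW// rate_lt.
have cvgT : (fun N => \sum_(k < N) u k * T k) @ \oo -->
    \sum_(i < J) (-1) ^+ i * polemom i s * (B i).[z].
  under eq_fun => N.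
    under eq_bigr do rewrite mulr_sumr.
    rewrite exchange_big/=.
    under eq_bigr => i _.
      under eq_bigr do rewrite mulrA.
      rewrite -mulr_suml.
      over.
    over.
  apply: (@cvg_sum_ord _ _ (fun i N => (\sum_(k < N) u k * modal_coef k i) * (B i).[z])
    (fun i => (-1) ^+ i * polemom i s * (B i).[z])) => i.
  by apply: cvgMr_tmp; exact: polemom_cvg.
have cvgZ : (fun N => \sum_(k < N) u k * (z - q) ^+ k) @ \oo --> (s + z)^-1.
  have x1 : `|- (z - q) / S| < 1.
    rewrite normrM normrN normfV (gtr0_norm S0) ltr_pdivrMr// mul1r.
    by apply: le_lt_trans zr _; exact: lt_le_trans sS.
  have -> : (s + z)^-1 = S^-1 * (1 - - (z - q) / S)^-1.
    rewrite -invfM; congr (_^-1); rewrite /S; field.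
    by rewrite gt_eqF.
  have := @cvg_geometric_series R S^-1 _ x1.
  apply: cvg_trans; apply: near_eq_cvg; apply: nearW => N.
  rewrite /series/= big_mkord; apply: eq_bigr => k _.
  rewrite /u [in LHS]exprMn (exprNn (z - q)) exprVn exprS invfM.
  by ring.
have lb N : (J <= N)%N -> `|\sum_(k < N) u k * (z - q) ^+ k -
    \sum_(k < N) u k * T k| <= D / (1 - th) * th ^+ J / S.
  move=> JN; rewrite -sumrB.
  apply: le_trans (ler_norm_sum _ _ _) _.
  apply: (@le_trans _ _ (\sum_(k < N) (if (J <= k)%N then D / S * th ^+ k else 0))).
    apply: ler_sum => k _; rewrite -mulrBr; case: leqP => [Jk|kJ]; last first.
      by rewrite Tlt// subrr mulr0 normr0.
    rewrite normrM uE distrC; apply: le_trans (ler_wpM2l _ (Tge k Jk)) _.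
      by rewrite invr_ge0 exprn_ge0// ltW.
    rewrite exprS invfM /th expr_div_n.
    rewrite [leLHS](_ : _ = D / S * (r ^+ k / S ^+ k)); last by ring.
    rewrite ler_wpM2l ?divr_ge0 ?(ltW S0)// ler_wpM2l ?exprn_ge0 ?(ltW r0)//.
    by rewrite lef_pV2 ?posrE ?exprn_gt0// lerXn2r ?nnegrE ?(ltW S0) ?(ltW sg0).
  rewrite (_ : D / (1 - th) * th ^+ J / S = D / S * (th ^+ J / (1 - th))).
    rewrite (eq_bigr (fun k : 'I_N => D / S * (if (J <= k)%N then th ^+ k else 0))).
      rewrite -mulr_sumr ler_wpM2l ?divr_ge0 ?(ltW S0)//.
      by apply: geometric_tail; rewrite th0.
    by move=> k _; case: ifP; rewrite ?mulr0.
  by ring.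
rewrite -/th; set l := \sum_(i < J) _ in cvgT *.
have cvgE : (fun N => `|\sum_(k < N) u k * (z - q) ^+ k - \sum_(k < N) u k * T k|)
    @ \oo --> `|(s + z)^-1 - l| by apply: cvg_norm; exact: cvgB.
by apply: (cvgr_to_le cvgE); exists J => // N /lb.
Qed.

(** From s + phi_g(t) = b^-|g| (b^|g| s + n(g) + t): stationarity replaces the pole s = n(a) by the
    poles n(a ++ g), and the power i + 1 absorbs the weight exactly. *)
Lemma polemom_stationary i s : 0 < s ->
  \esum_(g in langG w) (polemom i (b%:R ^+ size g * s + (nval g)%:R))%:E =
  (lambda R w i.+1 * polemom i s)%:E.
Proof.
move=> s0; pose f (t : measurableTypeR R) : \bar R := ((s + t) ^- i.+1)%:E.
have mf : measurable_fun I01 f by apply/measurable_EFinP; exact: measurable_pole.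
have f0 t : I01 t -> (0 <= f t)%E.
  move=> /I01E/andP[t0 _]; rewrite lee_fin invr_ge0 exprn_ge0//.
  by rewrite addr_ge0// ltW.
rewrite EFinM EFin_Rintegral; last exact: integrable_pole.
rewrite (stationary_integral b1 (hnu (ltn0Sn i)) mf f0); apply: eq_esum => g _.
have bg : 0 < b%:R ^+ size g :> R by rewrite exprn_gt0.
have cg : 0 <= b%:R ^- (i.+1 * size g) :> R by rewrite invr_ge0 exprn_ge0.
rewrite -ge0_integralZl_EFin//; first last.
- apply: (measurable_comp mI) => //; last exact: measurable_funTS (@measurable_phi R b g).
  by move=> _ [t /I01E t01 <-]; rewrite /I01/= in_itv/=; exact: phi_itv.
- by move=> t /I01E t01; apply: f0; rewrite /I01/= in_itv/=; exact: phi_itv.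
rewrite EFin_Rintegral; last first.
  by apply: integrable_pole; rewrite ltr_wpDr// mulr_gt0.
apply: eq_integral => t /set_mem/I01E/andP[t0 _]; rewrite -EFinM; congr EFin.
rewrite mulnC exprM -invfM -exprMn; congr (_ ^- _).
by rewrite phiE; field; rewrite gt_eqF.
Qed.

Lemma polemom_le i s : 1 <= s -> polemom i s <= s^-1.
Proof.
move=> s1; have s0 : 0 < s by rewrite (lt_le_trans ltr01).
apply: le_trans (ler_norm _) _.
apply: (Rintegral01_bound (nu1 i)); first exact: measurable_pole.
move=> t /I01E/andP[t0 _]; have st : 0 < s + t by rewrite ltr_wpDr.
rewrite ger0_norm; last by rewrite invr_ge0 exprn_ge0// ltW.
rewrite lef_pV2 ?posrE ?exprn_gt0//; apply: (@le_trans _ _ (s + t)); first by rewrite lerDl.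
by rewrite exprS ler_peMr ?(ltW st)// exprn_ege1//; lra.
Qed.

(** * Families of poles *)

Section Family.
Variable A : set (word b).
Hypothesis A0 : forall a, A a -> (0 < nval a)%N.
Hypothesis absumA : absum A (fun a => (nval a)%:R^-1 : R).

Definition pole_family z : R := sum_over A (fun a => ((nval a)%:R + z)^-1).
Definition polemom_sum i : R := sum_over A (fun a => polemom i (nval a)%:R).

Let A1 a : A a -> 1 <= (nval a)%:R :> R.
Proof. by move=> /A0 a0; rewrite ler1n. Qed.

Lemma absum_polemom i : absum A (fun a => polemom i (nval a)%:R).
Proof.
apply: absum_le absumA => a /A1 a1.
by rewrite ger0_norm ?polemom_le// polemom_ge0// (le_trans ler01).
Qed.

Lemma pole_family_expansion (r sg : R) : 1 + P^-1 < r -> r < sg ->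
  (forall a, A a -> sg <= (nval a)%:R + q) ->
  exists2 K : R, 0 <= K & forall z J, `|z - q| <= r ->
    absum A (fun a => ((nval a)%:R + z)^-1) /\
    `|pole_family z - \sum_(i < J) (-1) ^+ i * polemom_sum i * (B i).[z]| <=
      K * (r / sg) ^+ J.
Proof.
move=> rP rsg Asg; have [K K0 KP] := pole_expansion rP rsg.
have Pi : 0 < P^-1 by rewrite invr_gt0.
have r0 : 0 < r by lra. have sg0 : 0 < sg by lra.
have th0 : 0 <= r / sg by rewrite divr_ge0 ?ltW.
have /andP[q0 q1] := centre_itv.
pose N : R := sum_over A (fun a => (nval a)%:R^-1).
have N0 : 0 <= N.
  by apply: sum_over_ge0 => a /A1 a1; rewrite invr_ge0 (le_trans ler01).
exists (K * N); first exact: mulr_ge0.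
move=> z J zr.
have az : absum A (fun a => ((nval a)%:R + z)^-1).
  have d0 : 0 < 1 - r / sg by rewrite subr_gt0 ltr_pdivrMr// mul1r.
  apply: (absum_le (g := fun a => (1 - r / sg)^-1 * (nval a)%:R^-1)); last exact: absumZ.
  move=> a Aa; have a1 := A1 Aa; have sa := Asg _ Aa; set n : R := (nval a)%:R in a1 sa *.
  (* Here z >= q - r, and r <= (r / sg)(n + q) because the pole is at distance at least [sg]; this
     keeps n + z comparable to n even when z is negative. *)
  have nz : (1 - r / sg) * n <= n + z.
    have h : r <= r / sg * (n + q).
      by rewrite -mulrA ler_pMr// mulrC ler_pdivlMr// mul1r.
    have h2 : - r <= z - q by move: zr; rewrite ler_norml => /andP[].
    have h3 : r / sg <= 1 by rewrite ler_pdivrMr// mul1r ltW.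
    by nra.
  have n0 : 0 < n by rewrite (lt_le_trans ltr01).
  have p0 : 0 < (1 - r / sg) * n by rewrite mulr_gt0.
  rewrite ger0_norm; last by rewrite invr_ge0 (le_trans (ltW p0)).
  by rewrite -invfM lef_pV2 ?posrE// (lt_le_trans p0).
split=> //; rewrite /pole_family /polemom_sum.
pose F i (a : word b) : R := (-1) ^+ i * (B i).[z] * polemom i (nval a)%:R.
have -> : \sum_(i < J) (-1) ^+ i * sum_over A (fun a => polemom i (nval a)%:R) *
    (B i).[z] = sum_over A (fun a => \sum_(i < J) F i a).
  rewrite (@sum_over_sum _ _ A _ _ (fun i : 'I_J => F i)).
    apply: eq_bigr => i _; rewrite /F sum_overZ; last exact: absum_polemom.
    by ring.
  by move=> i; exact/absumZ/absum_polemom.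
have aF : absum A (fun a => \sum_(i < J) F i a).
  by apply: absum_sum => i; exact/absumZ/absum_polemom.
rewrite -sum_overB// mulrAC -sum_overZ//.
apply: ler_norm_sum_over; last exact: absumZ.
move=> a Aa; have a1 := A1 Aa; have n0 : 0 < (nval a)%:R :> R by rewrite (lt_le_trans ltr01).
have -> : \sum_(i < J) F i a =
    \sum_(i < J) (-1) ^+ i * polemom i (nval a)%:R * (B i).[z].
  by apply: eq_bigr => i _; rewrite /F; ring.
apply: le_trans (KP _ z J n0 (Asg _ Aa) zr) _.
rewrite ler_wpM2l ?mulr_ge0 ?exprn_ge0// lef_pV2 ?posrE//; last lra.
by rewrite lerDl.
Qed.

End Family.

(** * Left coefficients and terms of the series *)

(** Differentiating [fL] termwise produces (-1)^i i!, whose factorial cancels that of [modalL]; the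
    remaining sum of poles is non-negative and may be exchanged with the integral. *)
Lemma modalLE i : w <> [::] ->
  modalL w nu i.+1 = (-1) ^+ i * polemom_sum (headed (langL w)) i.
Proof.
move=> w0; set A := headed (langL w).
have A1 a : A a -> 1 <= (nval a)%:R :> R.
  by move=> [_ a0]; rewrite ler1n nval_gt0//; lia.
have aA : absum A (fun a => (nval a)%:R^-1 : R).
  exact/absum_headed/absum_langL.
rewrite /modalL /=.
have -> : \int[nu i.+1]_(t in `[0, 1]) derive1n i (fL w) t =
    \int[nu i.+1]_(t in I01) ((-1) ^+ i * i`!%:R *
      polesum A (fun a => (nval a)%:R) i.+1 t).
  apply: eq_Rintegral => t /set_mem/I01E/andP[t0 _].
  by apply: derive1n_polesum => //; lra.
have z2 t : I01 t -> - 2^-1 < t by move=> /I01E/andP[t0 _]; lra.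
have pE t : I01 t -> (polesum A (fun a => (nval a)%:R) i.+1 t)%:E =
    \esum_(a in A) (((nval a)%:R + t) ^- i.+1)%:E.
  move=> It; rewrite /polesum sum_overE//; last exact/absum_pole/z2.
  move=> a Aa; rewrite invr_ge0 exprn_ge0// addr_ge0//.
  by move/I01E/andP: It => [].
have mp : measurable_fun I01 (polesum A (fun a => (nval a)%:R) i.+1).
  apply/measurable_EFinP; apply: (eq_measurable_fun (fun t : measurableTypeR R =>
    \esum_(a in A) (((nval a)%:R + t) ^- i.+1)%:E)).
    by move=> t /set_mem It; rewrite /= pE.
  apply: measurable_fun_esum => //.
    move=> a Aa; apply/measurable_EFinP; apply: measurable_pole.
    by rewrite (lt_le_trans ltr01)// A1.
  move=> a t Aa /I01E/andP[t0 _].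
  by rewrite lee_fin invr_ge0 exprn_ge0// addr_ge0.
have pmsE : (\int[nu i.+1]_(t in I01) (polesum A (fun a => (nval a)%:R) i.+1 t)%:E)%E
    = (polemom_sum A i)%:E.
  rewrite /polemom_sum sum_overE; first last.
  - apply: absum_polemom => // a [_ a0]; apply: nval_gt0 => //; lia.
  - by move=> a Aa; apply: polemom_ge0.
  under eq_integral => t /set_mem It do rewrite pE//.
  rewrite ge0_integral_esum//; first last.
  - move=> a t Aa /I01E/andP[t0 _].
    by rewrite lee_fin invr_ge0 exprn_ge0// addr_ge0.
  - move=> a Aa; apply/measurable_EFinP; apply: measurable_pole.
    by rewrite (lt_le_trans ltr01)// A1.
  apply: eq_esum => a Aa; rewrite EFin_Rintegral//; apply: integrable_pole.
  by rewrite (lt_le_trans ltr01)// A1.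
have ip : (nu i.+1).-integrable I01 (EFin \o polesum A (fun a => (nval a)%:R) i.+1).
  apply/integrableP; split; first exact/measurable_EFinP.
  rewrite [X in (X < _)%E](_ : _ = (polemom_sum A i)%:E) ?ltry// -pmsE.
  apply: eq_integral => t /set_mem It; rewrite /= ger0_norm//.
  apply: sum_over_ge0 => a Aa.
  by rewrite invr_ge0 exprn_ge0// addr_ge0//; move/I01E/andP: It => [].
rewrite RintegralZl//; have -> : \int[nu i.+1]_(t in I01)
    polesum A (fun a => (nval a)%:R) i.+1 t = polemom_sum A i by rewrite /Rintegral pmsE.
have f0 : i`!%:R != 0 :> R by rewrite pnatr_eq0 -lt0n fact_gt0.
by rewrite -!mulrA mulrCA mulKf.
Qed.

Let headed_gt0 (u a : word b) : headed (langL u) a -> (0 < nval a)%N.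
Proof. by move=> [_ a0]; apply: nval_gt0 => //; lia. Qed.

Let absum_headed_langL (u : word b) : u <> [::] ->
  absum (headed (langL u)) (fun a => (nval a)%:R^-1 : R).
Proof. by move=> u0; exact/absum_headed/absum_langL. Qed.

Let w0 : w <> [::].
Proof. by case: fvw => + _ _ _ => /[swap] ->. Qed.

Let lam_neq0 i : lambda R w i.+1 != 0.
Proof. by rewrite gt_eqF// lambda_gt0. Qed.

Definition term i : R :=
  modalL w nu i.+1 * (lambda R w i.+1)^-1 * modalR w B i.+1.

Lemma polemom_sum_bordered i : v <> [::] ->
  polemom_sum (headed (langL w)) i = lambda R w i.+1 * polemom_sum (headed (langL v)) i.
Proof.
move=> v0; have pm0 a : 0 <= polemom i (nval a)%:R by exact: polemom_ge0.
have aw := absum_polemom (@headed_gt0 w) (absum_headed_langL w0) i.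
have av := absum_polemom (@headed_gt0 v) (absum_headed_langL v0) i.
apply: EFin_inj; rewrite EFinM /polemom_sum !sum_overE//.
rewrite (@esum_langL_bordered _ _ v w (fun a => polemom i (nval a)%:R))//.
rewrite -esumZl; [|exact/ltW/lambda_gt0|by move=> a _; rewrite lee_fin].
apply: eq_esum => a Aa; rewrite -EFinM -polemom_stationary; last first.
  by rewrite ltr0n (headed_gt0 Aa).
by apply: eq_esum => g _; rewrite nval_cat natrD natrM natrX mulrC.
Qed.

Lemma term_bordered i : v <> [::] -> term i =
  (-1) ^+ i * polemom_sum (headed (langL v)) i *
  sum_over (langR w) (fun g => wt R g * (B i).[xval R g]).
Proof.
move=> v0; rewrite /term modalLE// polemom_sum_bordered// /modalR integral_eta0//.
congr (_ * _); rewrite -!mulrA; congr (_ * _).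
by rewrite mulrCA mulfV// mulr1.
Qed.

Lemma term_unbordered i : ~ bordered w -> term i =
  b%:R ^+ size w * ((-1) ^+ i * polemom_sum (headed (langL w)) i *
                    (B i).[- (nval w)%:R]).
Proof.
move=> uw; have [_ _ KB] := hB i.
rewrite /term modalLE// /modalR (integral_eta0_unbordered b1 w0 uw KB).
by field; exact: lam_neq0.
Qed.

(** * The bordered case *)

(** The nearest conceivable pole is 1, so 1 + q has to exceed 1 + 1/P. If n(c) > 0, this holds
    because q >= 1/(P - 1). If n(c) = 0, then q = 0 and the value 1 must be excluded, which moves
    the poles to 2 or beyond. In both cases [r] is the midpoint of 1 + 1/P and [sg]. *)
Lemma bordered_radius : v <> [::] -> exists r sg : R,
  [/\ 1 + P^-1 < r, r < sg &
      forall a, headed (langL v) a -> sg <= (nval a)%:R + q].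
Proof.
move=> v0; have Pi : 0 < P^-1 by rewrite invr_gt0.
have /andP[q0 q1] := centre_itv.
have [c0|c0] := posnP (nval c); last first.
  have qP : P^-1 < q.
    apply: (@lt_le_trans _ _ ((P - 1)^-1)).
      by rewrite ltf_pV2 ?posrE//; lra.
    by rewrite /centre ler_peMl ?invr_ge0 ?(ltW PB0)// ler1n.
  exists (1 + (P^-1 + q) / 2), (1 + q); split; [lra|lra|].
  by move=> a Aa; have a0 := headed_gt0 Aa; rewrite lerD2r ler1n.
have Pi2 : P^-1 <= 2^-1 by rewrite lef_pV2 ?posrE.
exists (1 + (1 + P^-1) / 2), 2; split; [lra|lra|].
(* A word [a] of value 1 would force [v = [:: 1]], so that [w], hence [c], would
   end in 1, whereas here [nval c = 0]. *)
move=> a Aa; suff : (2 <= nval a)%N by rewrite -(ler_nat R) => ?; lra.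
have [[_ va] a0] := Aa; rewrite ltn_neqAle (headed_gt0 Aa) andbT eq_sym.
apply/eqP => a1; have := nval_ge a0; rewrite a1 => ha.
have sa : (size a <= 1)%N.
  rewrite leqNgt; apply/negP => sa; move: ha; rewrite leqNgt => /negP; apply.
  by rewrite -[X in (X < _)%N](expn0 b) ltn_exp2l//; case: (size a) sa => // -[].
case: a a1 sa va {Aa a0 ha} => [//|d []//]; rewrite nval1 => d1 _ vd.
have vE : v = [:: d].
  move: vd v0; case: v => // e s /suffixP[[|? []//] [-> <-]] //.
case: fvw => _ _ + _; rewrite wvc vE.
have := size_period_gt0; case/lastP: c c0 => // s e; rewrite nval_rcons => ce _.
rewrite -rcons_cat -cats1 => /suffixP[x].
rewrite cats1 -[[:: d]]/(rcons [::] d) -rcons_cat => /rcons_inj[_ ed].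
by move: ce; rewrite ed d1 addn1.
Qed.

(** The error of the expansion is uniform for z in [0, 1], hence survives the sum over [langR w],
    whose total weight is finite. *)
Lemma bordered_series : v <> [::] ->
  cvgn [normed series term] /\
  (limn (series term))%:E = (Iharm R w 0 - Iharm R v 0)%E.
Proof.
move=> v0; have [r [sg [rP rsg Asg]]] := bordered_radius v0.
set A := headed (langL v) in Asg *.
have A0 a : A a -> (0 < nval a)%N by exact: headed_gt0.
have aA := absum_headed_langL v0.
have [K K0 KP] := pole_family_expansion A0 aA rP rsg Asg.
have Pi : 0 < P^-1 by rewrite invr_gt0.
have th0 : 0 <= r / sg < 1.
  by rewrite divr_ge0 ?ltr_pdivrMr ?mul1r ?rsg//; lra.
have xr (g : word b) : `|xval R g - q| <= r.
  apply: (@le_trans _ _ 1); last by lra.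
  by apply: dist_centre; have /andP[? /ltW ?] := xval_itv R b1 g; apply/andP.
have aR := absum_langR R b1 w0.
pose f (g : word b) : R := wt R g * pole_family A (xval R g).
have absf : absum (langR w) f.
  apply: (absum_le (g := fun g => K * wt R g)); last exact: absumZ.
  move=> g _; rewrite normrM ger0_norm ?wt_ge0// mulrC ler_wpM2r ?wt_ge0//.
  by have [_] := KP _ 0%N (xr g); rewrite big_ord0 subr0 expr0 mulr1.
have [] := @series_geometric_approx R term (sum_over (langR w) f)
    (K * sum_over (langR w) (@wt R b)) (r / sg) th0.
  move=> J; pose F i (g : word b) : R :=
    (-1) ^+ i * polemom_sum A i * (wt R g * (B i).[xval R g]).
  have aF i : absum (langR w) (F i) by exact/absumZ/absum_horner_langR.
  have -> : \sum_(i < J) term i = sum_over (langR w) (fun g => \sum_(i < J) F i g).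
    rewrite (@sum_over_sum _ _ _ _ _ (fun i : 'I_J => F i))//.
    apply: eq_bigr => i _; rewrite term_bordered// sum_overZ//.
    exact: absum_horner_langR.
  rewrite -sum_overB//; last exact: absum_sum.
  rewrite mulrAC -sum_overZ//; apply: ler_norm_sum_over; last exact: absumZ.
  move=> g _; have [_ KJ] := KP _ J (xr g).
  have -> : f g - \sum_(i < J) F i g = wt R g *
      (pole_family A (xval R g) -
       \sum_(i < J) (-1) ^+ i * polemom_sum A i * (B i).[xval R g]).
    rewrite mulrBr; congr (_ - _); rewrite mulr_sumr; apply: eq_bigr => i _.
    by rewrite /F; ring.
  by rewrite normrM ger0_norm ?wt_ge0// mulrC ler_wpM2r ?wt_ge0.
move=> cvgt ->; split=> //.
have n0 (z : word b) : 0 <= (nval z)%:R^-1 :> R by rewrite invr_ge0.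
have nE (a g : word b) : (nval (a ++ g))%:R^-1 = wt R g * ((nval a)%:R + xval R g)^-1 :> R.
  have bg : b%:R ^+ size g != 0 :> R by rewrite expf_neq0// gt_eqF.
  rewrite /wt -invfM; congr (_^-1); rewrite nval_cat natrD natrM natrX /xval.
  by field.
have x0 (g : word b) : 0 <= xval R g by have /andP[] := xval_itv R b1 g.
(* Finiteness allows this term to be cancelled in the extended reals. *)
have Iv : Iharm R v 0 \is a fin_num.
  rewrite (IharmE R b1 v) -sum_overE//.
  exact: (absum_headed b1 (absum_avoid R b1 v0)).
rewrite (IharmE R b1 w) (@esum_avoid_split _ _ v w (fun z => (nval z)%:R^-1))//.
rewrite -(IharmE R b1 v) addeC addeK// esum_exchange; last first.
  by move=> a g; rewrite lee_fin.
rewrite sum_overE//; last first.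
  move=> g _; rewrite mulr_ge0 ?wt_ge0//; apply: sum_over_ge0 => a _.
  by rewrite invr_ge0 addr_ge0.
apply: eq_esum => g _; rewrite /f EFinM sum_overE; last first.
- by have [] := KP _ 0%N (xr g).
- by move=> a _; rewrite invr_ge0 addr_ge0.
rewrite -esumZl ?wt_ge0//; last by move=> a _; rewrite lee_fin invr_ge0 addr_ge0.
by apply: eq_esum => a _; rewrite nE EFinM.
Qed.

(** * The unbordered case *)

Lemma unbordered_series0 : ~ bordered w -> first_digit w = 0%N ->
  cvgn [normed series term] /\ (limn (series term))%:E = Iharm R w 0.
Proof.
move=> uw fw; set A := headed (langL w); set n : R := (nval w)%:R.
have A0 a : A a -> (0 < nval a)%N by exact: headed_gt0.
have aA := absum_headed_langL w0.
have Pi : 0 < P^-1 by rewrite invr_gt0.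
have Pi2 : P^-1 <= 2^-1 by rewrite lef_pV2 ?posrE.
have /andP[q0 q1] := centre_itv.
have n0 : 0 <= n by [].
pose bw : R := b%:R ^+ size w; have bw0 : 0 < bw by rewrite exprn_gt0.
have bw2 : 2 <= bw.
  apply: (@le_trans _ _ (b%:R : R)); first by rewrite (ler_nat _ 2 b).
  by rewrite -[leLHS]expr1 ler_eXn2l//; case: (w) w0.
have nE (z : word b) : (nval (z ++ w))%:R = (nval z)%:R * bw + n :> R.
  by rewrite nval_cat natrD natrM natrX.
(* Each pole is n(z ++ w) = n(z) b^|w| + n(w) with n(z) >= 1 and b^|w| >= 2. *)
have Asg a : A a -> n + q + 2 <= (nval a)%:R + q.
  move=> Aa; have [/(langL_strip w0)[z az _] a0] := Aa.
  have z0 : 1 <= (nval z)%:R :> R.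
    rewrite ler1n nval_gt0 ?(ltnW b1)//; move: a0; rewrite az.
    by case: (z) => [|//]; rewrite /= fw.
  rewrite az nE; nra.
(* The radius must reach |-n - q| = n + q, exceed 1 + 1/P, which is at most 3/2, and stay below n +
   q + 2; adding 7/4 to n + q achieves all three. *)
have rP : 1 + P^-1 < n + q + 7 / 4 by lra.
have rsg : n + q + 7 / 4 < n + q + 2 by lra.
have [K K0 KP] := pole_family_expansion A0 aA rP rsg Asg.
set th := _ / (n + q + 2) in KP.
have th0 : 0 <= th < 1.
  have sg0 : 0 < n + q + 2 by lra.
  apply/andP; split; first by apply: divr_ge0; lra.
  by rewrite ltr_pdivrMr// mul1r.
have zr : `|- n - q| <= n + q + 7 / 4 by rewrite ler_norml; lra.
have [] := @series_geometric_approx R term (bw * pole_family A (- n)) (bw * K) th th0.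
  move=> J; have [_ KJ] := KP _ J zr.
  rewrite (eq_bigr (fun i : 'I_J => bw * ((-1) ^+ i * polemom_sum A i * (B i).[- n]))).
    by rewrite -mulr_sumr -mulrBr normrM gtr0_norm// -[leRHS]mulrA ler_pM2l.
  by move=> i _; rewrite term_unbordered.
move=> cvgt ->; split=> //.
have Ap a : A a -> 0 <= ((nval a)%:R - n)^-1.
  by move=> /Asg h; rewrite invr_ge0; lra.
rewrite EFinM /pole_family sum_overE//; last by have [] := KP _ 0%N zr.
rewrite -esumZl ?(ltW bw0)//.
(* At -n(w), the pole of [z ++ w] contributes 1/(n(z) b^|w|), and the factor [bw] turns it into
   1/n(z). *)
rewrite /A esum_langL_unbordered// (IharmE R b1 w); apply: eq_esum => z _.
by rewrite nE addrK -EFinM invfM mulrCA mulfV ?gt_eqF// mulr1.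
Qed.

(* Convexity of [x |-> x^-(i+1)] at [s + q]; the first-order term is a
   coefficient of the expansion of [(X - q)^(i+1)], hence small. *)
Lemma polemom_lower i s : 0 < s ->
  (s + q) ^- i.+1 * (1 - modal_coef i.+1 i / (s + q)) <= polemom i s.
Proof.
move=> s0; have /andP[q0 q1] := centre_itv; set S := s + q.
have S0 : 0 < S by rewrite /S; lra.
have iq := integrable_sub i 1.
pose k : R := i.+1%:R * S ^- i.+2.
have ci : (nu i.+1).-integrable I01 (EFin \o cst (S ^- i.+1)).
  by apply: (@bounded_integrable01 _ _ (cst (S ^- i.+1)) `|S ^- i.+1|) => // x _.
have ik : (nu i.+1).-integrable I01 (EFin \o fun t : R => k * (t - q) ^+ 1).
  exact: (integrableZl mI k iq).
have -> : S ^- i.+1 * (1 - modal_coef i.+1 i / S) =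
    \int[nu i.+1]_(t in I01) (S ^- i.+1 - k * (t - q) ^+ 1).
  rewrite RintegralB// (Rintegral01_cst (nu1 i)) RintegralZl//.
  rewrite modal_coefE subSnn binSn /k [S ^+ i.+2]exprS invfM.
  by ring.
apply: le_Rintegral => //; [exact: (integrableB mI ci ik)|exact: integrable_pole|].
move=> t /I01E/andP[t0 _]; have st : 0 < s + t by rewrite ltr_wpDr.
apply: le_trans (invX_convex i.+1 st S0).
by rewrite /k expr1 le_eqVlt; apply/orP; left; apply/eqP; rewrite /S; ring.
Qed.

(** With S = n(w) + q, the lower modes perturb |B i (-n(w))| from S^i by at most C gap (rate S)^i,
    while the left sum is at least about S^-(i+1). The powers of S cancel in the product, which
    therefore does not tend to 0. *)
Lemma unbordered_series_dvg : v = [::] -> ~ bordered w ->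
  first_digit w <> 0%N -> ~ cvgn (series term).
Proof.
move=> v0 uw fw /cvg_series_cvg_0 term0.
have cw : c = w by rewrite wvc v0.
set n : R := (nval w)%:R; set S := n + q.
have fw0 : (0 < first_digit w)%N by rewrite lt0n; apply/eqP.
have n1 : 1 <= n by rewrite ler1n nval_gt0// ltnW.
have n0 : 0 < n by lra.
have Pi : 0 < P^-1 by rewrite invr_gt0.
have qP : P^-1 < q.
  apply: (@lt_le_trans _ _ ((P - 1)^-1)).
    by rewrite ltf_pV2 ?posrE//; lra.
  by rewrite /centre cw ler_peMl ?invr_ge0 ?(ltW PB0).
have SP : 1 + P^-1 < S by rewrite /S; lra.
have S1 : 1 <= S by lra.
have S0 : 0 < S by lra.
have rt := rate_lt SP.
have rate0 : 0 <= rate S by rewrite addr_ge0// divr_ge0 ?(ltW b0)//; lra.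
pose th := rate S / S; have th0 : 0 <= th by rewrite divr_ge0// ltW.
have th1 : th < 1 by rewrite ltr_pdivrMr// mul1r.
have rtE m : rate S ^+ m = th ^+ m * S ^+ m by rewrite -exprMn divfK// gt_eqF.
have [C C0 BC] := modal_poly_le SP.
have zq : `|- n - q| = S by rewrite -opprD normrN gtr0_norm.
have Blow m : S ^+ m * (1 - C * gap * th ^+ m) <= `|(B m).[- n]|.
  rewrite XsubC_expansion; apply: le_trans (lerB_dist _ _).
  rewrite normrX zq mulrBr mulr1 lerD2l lerN2.
  apply: le_trans (ler_norm_sum _ _ _) _.
  have -> : S ^+ m * (C * gap * th ^+ m) = C * (gap * rate S ^+ m) by rewrite rtE; ring.
  apply: le_trans (ler_wpM2l (ltW C0) (modal_coef_sum_le m S1)).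
  rewrite mulr_sumr; apply: ler_sum => j _; rewrite normrM mulrCA ler_wpM2l//.
  by apply: BC; rewrite zq.
(* All the poles contribute non-negatively, so the one of [w] alone gives a lower bound. *)
have Alow i : S ^- i.+1 * (1 - gap * th ^+ i.+1) <= polemom_sum (headed (langL w)) i.
  apply: (@le_trans _ _ (polemom i n)); last first.
    apply: (@sum_over_ge _ _ _ (fun a => polemom i (nval a)%:R) w).
    - split=> //; split; last exact: suffix_refl.
      exact: occ_self.
    - by move=> a _; exact: polemom_ge0.
    - exact: absum_polemom (@headed_gt0 w) (absum_headed_langL w0) i.
  apply: le_trans (polemom_lower i n0); rewrite -/S.
  rewrite ler_wpM2l ?invr_ge0 ?exprn_ge0 ?(ltW S0)// lerD2l lerN2.
  rewrite ler_pdivrMr//; apply: le_trans (ler_norm _) _.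
  rewrite -(ler_pM2r (exprn_gt0 i S0)).
  have -> : gap * th ^+ i.+1 * S * S ^+ i = gap * rate S ^+ i.+1.
    by rewrite rtE [S ^+ i.+1]exprS; ring.
  apply: le_trans (modal_coef_sum_le i.+1 S1); rewrite big_ord_recr/= lerDr.
  by apply: sumr_ge0 => j _; rewrite mulr_ge0 ?exprn_ge0// ltW.
have geo (k : R) : (fun i => k * th ^+ i) @ \oo --> (0 : R).
  by apply: cvg_geometric; rewrite ger0_norm.
have half0 : 0 < 2^-1 :> R by [].
pose bw : R := b%:R ^+ size w; have bw0 : 0 < bw by rewrite exprn_gt0.
(* Each of the two factors will keep at least half of its main part, so the terms are at least bw /
   S / 4 in absolute value, contradicting the bound with 8. *)
have e0 : 0 < bw / S / 8 by rewrite !divr_gt0.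
have [i []] : exists i, [/\ `|term i| <= bw / S / 8,
    C * gap * th ^+ i <= 2^-1 & gap * th ^+ i <= 2^-1].
  have h0 : \forall i \near \oo, `|term i| <= bw / S / 8 by exact: cvgr0_norm_le.
  have h1 : \forall i \near \oo, `|C * gap * th ^+ i| <= 2^-1.
    by apply: cvgr0_norm_le => //; exact: geo.
  have h2 : \forall i \near \oo, `|gap * th ^+ i| <= 2^-1.
    by apply: cvgr0_norm_le => //; exact: geo.
  have : \forall i \near \oo, [/\ `|term i| <= bw / S / 8,
      C * gap * th ^+ i <= 2^-1 & gap * th ^+ i <= 2^-1].
    near=> i; split; [by near: i| |]; apply: le_trans (ler_norm _) _; by near: i.
  by move=> [N _ NP]; exists N; apply: NP => /=.
rewrite term_unbordered// -/bw !normrM (gtr0_norm bw0) normrX normrN1 expr1n mul1r.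
move=> ti Ci gi.
have gi' : gap * th ^+ i.+1 <= 2^-1.
  apply: le_trans gi; rewrite ler_wpM2l ?gap_ge0// exprS ler_piMl ?exprn_ge0//.
  exact: ltW.
have Si : 0 < S ^+ i by rewrite exprn_gt0.
have Bi : S ^+ i / 2 <= `|(B i).[- n]|.
  by apply: le_trans (Blow i); rewrite ler_pM2l//; lra.
have Ai : S ^- i.+1 / 2 <= `|polemom_sum (headed (langL w)) i|.
  apply: le_trans (ler_norm _); apply: le_trans (Alow i).
  by rewrite ler_pM2l ?invr_gt0 ?exprn_gt0//; lra.
have : S^-1 / 4 <= `|polemom_sum (headed (langL w)) i| * `|(B i).[- n]|.
  have -> : S^-1 / 4 = (S ^- i.+1 / 2) * (S ^+ i / 2).
    by rewrite exprS invfM; field; rewrite !gt_eqF.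
  apply: ler_pM => //; apply: ltW; first by rewrite divr_gt0 ?invr_gt0 ?exprn_gt0.
  by rewrite divr_gt0.
move=> /(ler_wpM2l (ltW bw0)) h; have := le_trans h ti.
have : 0 < bw / S by rewrite divr_gt0.
lra.
Unshelve. all: by end_near. Qed.

End Modal.

Theorem theorem6 (R : realType) (b : nat) (hb : (2 <= b)%N)
    (w : word b) (hw : w <> [::])
    (nu : nat -> probability (measurableTypeR R) R)
    (hnu : forall j : nat, (1 <= j)%N -> stationary w j (nu j))
    (B : nat -> {poly R})
    (hB : forall m : nat, modal_poly w m (B m)) :
  (* index shift: [a n] is the term j = n + 1 of the series *)
  let a : nat -> R := fun n =>
    modalL w nu n.+1 * (lambda R w n.+1)^-1 * modalR w B n.+1 in
  [/\ ~ bordered w -> first_digit w <> 0%N -> ~ cvgn (series a),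
      ~ bordered w -> first_digit w = 0%N ->
        cvgn [normed series a] /\ (limn (series a))%:E = Iharm R w 0 &
      forall v : word b, longest_border v w ->
        cvgn [normed series a] /\
        (limn (series a))%:E = (Iharm R w 0 - Iharm R v 0)%E].
Proof.
move=> a; split.
- move=> uw fw; have fv := fallback_unbordered hw uw.
  exact: (unbordered_series_dvg hb fv (erefl w) hnu hB (erefl _) uw fw).
- move=> uw fw; have fv := fallback_unbordered hw uw.
  exact: (unbordered_series0 hb fv (erefl w) hnu hB uw fw).
- move=> v lv; have [[v0 _ _ _] _] := lv.
  have fv := fallback_longest_border lv.
  have [_ [c [_ wvc _ _]]] := fallback_cat fv.
  exact: (bordered_series hb fv wvc hnu hB v0).
Qed.
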